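(* Let $U$ be an optimal prefix-free machine and let $f:2^\omega\to[0,1]$, $f(x)=\sum_{\sigma\le_L x}2^{-K_U(\sigma)}$. There are $2^{\aleph_0}$ many reals $x\in 2^\omega$ such that $f(x)$ is not 1-random.
   Context: A machine is a partial computable function $M$ from $2^{<\omega}$ to $2^{<\omega}$; it is prefix-free if its domain is a prefix-free set. $K_M(\sigma)=\min\{|\tau|: M(\tau)=\sigma\}$ ($=\infty$ if there is no such $\tau$, with $2^{-\infty}=0$). A prefix-free machine $U$ is optimal if for each prefix-free machine $M$ there is a constant $c$ with $K_U(\sigma)\le K_M(\sigma)+c$ for all $\sigma$. For $\sigma\in 2^{<\omega}$ and $x\in 2^\omega$, $\sigma<_L x$ means that there is $n$ with $\sigma\upharpoonright n=x\upharpoonright n$, $\sigma(n)=0$ and $x(n)=1$; $\sigma\le_L x$ means that $\sigma<_L x$ or $\sigma$ is an initial segment of $x$. A real $y$ is 1-random if there is a constant $c$ with $K_U(y\upharpoonright n)\ge n-c$ for all $n$. Reals in $[0,1]$ are identified with their binary expansions. *)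

(* Defs.v *)
From HB Require Import structures.
From mathcomp Require Import all_boot all_order all_algebra.
From mathcomp Require Import all_classical all_reals all_analysis.

Set Implicit Arguments.
Unset Strict Implicit.
Unset Printing Implicit Defensive.

Import Order.TTheory GRing.Theory Num.Theory.
Import numFieldNormedType.Exports.

Local Open Scope classical_set_scope.
Local Open Scope ring_scope.

(** Kleene's partial recursive functions of type [nat ^ n -> nat]. *)
Inductive recfun : nat -> Type :=
| Zero n : recfun n
| Succ : recfun 1
| Proj n (i : 'I_n) : recfun n
| Comp m n (f : recfun m) (g : 'I_m -> recfun n) : recfun n
| Prec n (f : recfun n) (g : recfun n.+2) : recfun n.+1
| Mu n (f : recfun n.+1) : recfun n.

(** [prim_rec F G v k y]: the value at [k] of the (partial) function defined
    by primitive recursion from the graphs [F] and [G] with parameters [v]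
    is defined and equal to [y]. *)
Fixpoint prim_rec n (F : n.-tuple nat -> nat -> Prop)
    (G : n.+2.-tuple nat -> nat -> Prop) (v : n.-tuple nat) (k y : nat) :
    Prop :=
  match k with
  | 0%N => F v y
  | k'.+1 => exists2 z, prim_rec F G v k' z & G [tuple of k' :: z :: v] y
  end.

(** [recfun_eval f v y]: the computation of [f] on [v] converges with value [y].
    In the [Mu] case all the values at arguments below [y] must be defined
    (and nonzero). *)
Fixpoint recfun_eval n (f : recfun n) : n.-tuple nat -> nat -> Prop :=
  match f in recfun n return n.-tuple nat -> nat -> Prop with
  | Zero _ => fun _ y => y = 0%N
  | Succ => fun v y => y = (thead v).+1
  | Proj _ i => fun v y => y = tnth v i
  | Comp m _ f g => fun v y =>
      exists2 w : m.-tuple nat, forall i, recfun_eval (g i) v (tnth w i) & recfun_eval f w y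
  | Prec n f g => fun v y =>
      prim_rec (recfun_eval f) (recfun_eval g) [tuple of behead v] (thead v) y
  | Mu _ f => fun v y =>
      recfun_eval f [tuple of y :: v] 0 /\
      forall k, (k < y)%N -> exists z, recfun_eval f [tuple of k :: v] z.+1
  end.

(** Bijective base-2 numeration, least significant digit first: a computable
    bijection from finite binary strings onto [nat]. *)
Fixpoint strcode (s : bitseq) : nat :=
  if s is b :: s' then ((strcode s').*2 + b).+1 else 0%N.

(** A partial function on binary strings; [None] means undefined. *)
Definition pfun_str := bitseq -> option bitseq.

Definition partial_computable (M : pfun_str) : Prop :=
  exists e : recfun 1,
    forall s y, recfun_eval e [tuple strcode s] y <->
                exists2 t, M s = Some t & y = strcode t.

Definition prefix_free (A : set bitseq) : Prop :=
  forall s t, A s -> A t -> prefix s t -> s = t.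

Definition prefix_free_machine (M : pfun_str) : Prop :=
  partial_computable M /\ prefix_free [set s | M s <> None].

Section Complexity.
Variable R : realType.
Implicit Types (M U : pfun_str) (s t : bitseq) (x z : nat -> bool).

(** The infimum of the empty set is [+oo]; over a nonempty set of lengths it
    is a minimum. *)
Definition K M s : \bar R :=
  ereal_inf [set (size t)%:R%:E | t in [set t | M t = Some s]].

Definition optimal U : Prop :=
  prefix_free_machine U /\
  forall M, prefix_free_machine M ->
    exists c : nat, forall s, (K U s <= K M s + c%:R%:E)%E.

Definition pow2N (k : \bar R) : \bar R :=
  if k is r%:E then (2 `^ (- r))%:E else 0%E.

Definition ltL s x : Prop :=
  exists n, [/\ (n < size s)%N, take n s = mkseq x n,
                nth false s n = false & x n = true].

Definition leL s x : Prop := ltL s x \/ s = mkseq x (size s).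

(** For a prefix-free [U] the sum is at most 1 by Kraft's inequality, so that
    [fine] loses nothing. *)
Definition Omega_fun U x : R :=
  fine (\esum_(s in [set s | leL s x]) pow2N (K U s)).

Definition random_seq U z : Prop :=
  exists c : nat, forall n : nat, ((n%:R - c%:R)%:E <= K U (mkseq z n))%E.

Definition binary_expansion (y : R) z : Prop :=
  [series (z n)%:R / 2 ^+ n.+1 : R]_n @ \oo --> y.

(** A dyadic rational has two binary expansions, neither of them random, so
    the choice of the expansion is immaterial. *)
Definition random_real U (y : R) : Prop :=
  exists2 z, binary_expansion y z & random_seq U z.

End Complexity.

(* Main.v *)
Require Import Defs.
From mathcomp Require Import all_boot all_order all_algebra.
From mathcomp Require Import all_classical all_reals all_analysis.
From mathcomp Require Import zify ring lra.

(** A string [s] sits in the order [leL] at its dyadic value: [leL s x] holds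
    iff [0.s <= 0.x] (lemma [leL_dyadic]). So [f = Omega_fun U] is the
    distribution function of the weights [2^-K(s)], and a cone [sigma] with a
    grid of dyadic points cuts a segment of the unit interval into a row of
    blocks: the values of [f] at the points are the boundaries, and the length
    of a block is the weight of the strings between two neighbouring points.

    The heart of the proof is [cone_not_random]: for every [c], every cone
    contains a cone on which no value [f(x)] is random with constant [c]. A
    Cantor scheme then gives as many branches as there are reals, each of which
    enters such a cone for every [c], and Cantor-Bernstein concludes.

    Suppose that in some cone [sigma] the reals with values that are random with
    constant [c] are dense. Since [f] is continuous ([Omega_continuous]), a
    boundary can never end up just to the right of a dyadic rational [q] of
    level [k], namely within [2^-(k+m)], once the [k] bits of [q] followed by
    [m] zeros have a description shorter than [k + m - c] ([random_gap]). Three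
    machines exploit this against [U]. The first gives such descriptions to the
    grids of many scales, with [m] so large that the forbidden intervals have
    small total length. The second gives some weight [u] to every point of a
    very fine grid of the cone. The third ([push_machine]) watches the
    enumeration of [U]. Whenever the row is calm, that is, no boundary
    approximated so far lies in a forbidden interval, it requests weight [u] for
    a fresh string of zeros; it has value [0], so it counts for every boundary,
    and when [U] serves the request the entire row moves to the right by [u].
    Then it waits for the row to be calm again. The approximations converge to
    boundaries that avoid the forbidden intervals, so calm always returns, and
    all the requests that the machine can afford are made and served.

    That is impossible ([game]). In a calm row, each grid point lies in a block
    that is longer than its forbidden interval. While the row is pushed to the
    right, the point is handed down from block to block, and a block that was
    tiny at first has to be fed before it can take the point over; so the
    weight added around the point is at least the distance of the push
    ([visits_le]). Different points are fed separately, whereas one push moves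
    the whole row, so [N] points make the row grow by [N] times the push
    ([phase_growth]). The total weight is at most [1] by Kraft's inequality,
    and [N] can exceed the factor that is lost in the constants of [U].

    Blocks that are long from the start cost nothing, and they are the reason
    for the many scales. Relative to a scale, huge blocks come near few grid
    points; blocks of medium size are scarce at one of the scales, because the
    ranges of medium sizes of the different scales are disjoint ([few_medium]);
    and the tiny blocks keep filling a fixed part of the row, because all but
    few of the blocks remain tiny ([tiny_ge]). So at each time some scale has
    enough grid points that see little else than tiny blocks ([good_scale]).

    All constants depend on a number [a] that also serves as the length of the
    headers of the codes, and that is taken above the optimality constants of
    the three machines; a codeword with [n] bits of payload then costs at most
    [2 * a + 1 + n] for [U]. *)

Set Implicit Arguments.
Unset Strict Implicit.
Unset Printing Implicit Defensive.

Import Order.TTheory GRing.Theory Num.Theory.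
Import numFieldNormedType.Exports.
Local Open Scope classical_set_scope.

(** * Computable functions *)

(** The arguments are read off a list of any length, and missing ones count as
    [0]; so functions of different arities live in one type and the closure
    lemmas need not match arities. *)
Definition computable (F : seq nat -> nat) : Prop :=
  forall n, exists e : recfun n,
    forall (v : n.-tuple nat) y, recfun_eval e v y <-> y = F v.

Lemma computable_eq F G : F =1 G -> computable F -> computable G.
Proof.
by move=> FG cF n; have [e He] := cF n; exists e => v y; rewrite He FG.
Qed.

Lemma computable_nth i : computable (fun v => nth 0 v i).
Proof.
move=> n; case: (ltnP i n) => [ltin|lein].
  by exists (Proj (Ordinal ltin)) => v y /=; rewrite (tnth_nth 0).
by exists (Zero n) => v y /=; rewrite nth_default ?size_tuple.
Qed.

Lemma computable_comp F (Gs : seq (seq nat -> nat)) :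
  computable F -> (forall i, i < size Gs -> computable (nth (fun=> 0) Gs i)) ->
  computable (fun v => F [seq G v | G <- Gs]).
Proof.
move=> cF cGs n; have [eF HF] := cF (size Gs).
have /boolp.choice [g Hg] : forall i : 'I_(size Gs), exists e : recfun n,
    forall (v : n.-tuple nat) y, recfun_eval e v y <-> y = (nth (fun=> 0) Gs i) v.
  by move=> i; exact: cGs.
exists (Comp eF g) => v y /=.
have mapE (w : (size Gs).-tuple nat) : (forall i, recfun_eval (g i) v (tnth w i)) <->
    w = [seq G (val v) | G <- Gs] :> seq nat.
  split=> [gw|wE i].
    apply: (@eq_from_nth _ 0); rewrite ?size_map ?size_tuple // => i lti.
    have /Hg := gw (Ordinal lti); rewrite (tnth_nth 0) /= => ->.
    by rewrite (nth_map (fun=> 0)).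
  apply/Hg; rewrite (tnth_nth 0) wE.
  by rewrite (nth_map (fun=> 0)).
split=> [[w /mapE wE /HF ->]|->]; first by rewrite wE.
exists (map_tuple (fun G => G (val v)) (in_tuple Gs)); first exact/mapE.
exact/HF.
Qed.

Lemma computable_comp1 (f : nat -> nat) F :
  computable (fun w => f (nth 0 w 0)) -> computable F ->
  computable (fun v => f (F v)).
Proof.
move=> cf cF; apply: (@computable_comp (fun w => f (nth 0 w 0)) [:: F]) => //.
by case.
Qed.

Lemma computable_behead F : computable F -> computable (fun v => F (behead v)).
Proof.
move=> cF [|n]; last first.
  have [eF HF] := cF n.
  exists (Comp eF (fun i => Proj (lift ord0 i))) => v y /=.
  split=> [[w wE /HF ->]|->].
    congr F; apply: (@eq_from_nth _ 0); rewrite ?size_behead ?size_tuple // => i lti.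
    have := wE (Ordinal lti); rewrite !(tnth_nth 0) /= => ->.
    by rewrite nth_behead.
  exists (behead_tuple v) => [i|]; last exact/HF.
  by rewrite !(tnth_nth 0) /= nth_behead.
have [eF HF] := cF 0; exists eF => v y.
by rewrite HF !tuple0.
Qed.

Lemma computable_nth_behead (g : seq nat -> seq nat) i :
  computable (fun v => nth 0 (g v) i.+1) ->
  computable (fun v => nth 0 (behead (g v)) i).
Proof. by apply: computable_eq => v; rewrite nth_behead. Qed.

Lemma computable_rec B F G : computable B -> computable F -> computable G ->
  computable (fun v => nat_rect (fun=> nat) (F v) (fun k z => G [:: k, z & v]) (B v)).
Proof.
move=> cB cF cG n.
have [eB HB] := cB n; have [eF HF] := cF n; have [eG HG] := cG n.+2.
pose args (i : 'I_n.+1) := if unlift ord0 i is Some j then Proj j else eB.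
exists (Comp (Prec eF eG) args) => v y /=.
have argsE (w : n.+1.-tuple nat) :
    (forall i, recfun_eval (args i) v (tnth w i)) <-> w = B v :: v :> seq nat.
  split=> [wE|wE i].
    case/tupleP: w wE => b w wE /=; congr cons.
      have := wE ord0; rewrite /args unlift_none => /HB.
      by rewrite (tnth_nth 0).
    apply: (@eq_from_nth _ 0); rewrite ?size_tuple // => i lti.
    have := wE (lift ord0 (Ordinal lti)); rewrite /args liftK /= !(tnth_nth 0) /=.
    by [].
  rewrite /args; case: unliftP => [j ->|->] /=; rewrite !(tnth_nth 0) wE //=.
  exact/HB.
have recE (v' : n.-tuple nat) k z :
    prim_rec (recfun_eval eF) (recfun_eval eG) v' k z <->
    z = nat_rect (fun=> nat) (F v') (fun k z => G [:: k, z & v']) k.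
  elim: k z => [|k IH] z /=; first exact: HF.
  split=> [[z' /IH -> /HG ->] //|->].
  by eexists; [exact/IH|exact/HG].
split=> [[w /argsE wE /recE ->]|->].
  have -> : thead w = B v by rewrite /thead (tnth_nth 0) wE.
  by have -> : [tuple of behead w] = v by apply: val_inj; rewrite /= wE.
exists (cons_tuple (B v) v); first exact/argsE.
by apply/recE; rewrite /thead (tnth_nth 0) /=.
Qed.

Lemma computable_rec2 B F (G : nat -> nat -> seq nat -> nat) :
  computable B -> computable F ->
  computable (fun w => G (nth 0 w 0) (nth 0 w 1) (behead (behead w))) ->
  computable (fun v => nat_rect (fun=> nat) (F v) (fun k z => G k z v) (B v)).
Proof.
by move=> cB cF cG; exact: (computable_rec cB cF cG).
Qed.

Lemma computable_succ F : computable F -> computable (fun v => (F v).+1).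
Proof.
move=> cF; apply: (@computable_comp (fun w => (nth 0 w 0).+1) [:: F]); last by case.
case=> [|n].
  exists (Comp Succ (fun=> Zero 0)) => v y /=; split.
    by move=> [w wE ->]; rewrite tuple0 /= /thead wE.
  move=> ->; exists [tuple of [:: 0]]; first by move=> i; rewrite (ord1 i).
  by rewrite tuple0.
exists (Comp Succ (fun=> Proj ord0)) => v y /=; split.
  by move=> [w wE ->]; rewrite /thead wE (tnth_nth 0).
move=> ->; exists [tuple of [:: thead v]]; last by rewrite /thead !(tnth_nth 0).
by move=> i; rewrite (ord1 i).
Qed.

Lemma computable_const c : computable (fun=> c).
Proof.
elim: c => [|c IH]; last exact: (computable_succ IH).
by move=> n; exists (Zero n).
Qed.


(** Change of variables: the first arguments are computed from the old ones and
    the others are shifted. *)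
Lemma computable_cat_drop k F (As : seq (seq nat -> nat)) : computable F ->
  (forall i, i < size As -> computable (nth (fun=> 0) As i)) ->
  computable (fun v => F ([seq A v | A <- As] ++ drop k v)).
Proof.
move=> cF cAs n.
have [eF HF] := cF (size As + (n - k)).
have /boolp.choice [g Hg] : forall i : 'I_(size As), exists e : recfun n,
    forall (v : n.-tuple nat) y, recfun_eval e v y <-> y = nth (fun=> 0) As i v.
  by move=> i; exact: cAs.
have ltk (j : 'I_(n - k)) : k + j < n by have := ltn_ord j; lia.
pose args (i : 'I_(size As + (n - k))) :=
  match fintype.split i with inl j => g j | inr j => Proj (Ordinal (ltk j)) end.
have argsE (v : n.-tuple nat) (w : (size As + (n - k)).-tuple nat) :
    (forall i, recfun_eval (args i) v (tnth w i)) <->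
    w = [seq A (val v) | A <- As] ++ drop k v :> seq nat.
  split=> [wE|wE i].
    apply: (@eq_from_nth _ 0) => [|i].
      by rewrite size_cat size_map size_drop !size_tuple.
    rewrite size_tuple => lti; have := wE (Ordinal lti).
    rewrite /args nth_cat size_map !(tnth_nth 0) /=.
    case: splitP => [j /= ij|j /= ij].
      by move=> /Hg ->; rewrite ij ?ltn_ord (nth_map (fun=> 0)).
    by move=> /= ->; rewrite (tnth_nth 0) ij ?ltnNge ?leq_addr /= addKn nth_drop.
  rewrite /args (tnth_nth 0) wE nth_cat size_map.
  case: splitP => [j ij|j ij].
    by apply/Hg; rewrite ij ?ltn_ord (nth_map (fun=> 0)).
  by rewrite /= (tnth_nth 0) ij ?ltnNge ?leq_addr /= addKn nth_drop.
exists (Comp eF args) => v y /=; split=> [[w /argsE wE /HF ->]|->].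
  by rewrite wE.
have sz : size ([seq A (val v) | A <- As] ++ drop k v) == size As + (n - k).
  by rewrite size_cat size_map size_drop size_tuple.
by exists (Tuple sz); [exact/argsE|exact/HF].
Qed.

Lemma computable_reindex k F (As : seq (seq nat -> nat)) G : computable F ->
  (forall i, i < size As -> computable (nth (fun=> 0) As i)) ->
  (forall v, F ([seq A v | A <- As] ++ drop k v) = G v) -> computable G.
Proof. by move=> cF cAs /computable_eq; apply; exact: computable_cat_drop. Qed.

Lemma computable_cons_drop k F A : computable F -> computable A ->
  computable (fun v => F (A v :: drop k v)).
Proof.
by move=> cF cA; apply: (@computable_cat_drop k F [:: A]) => // -[].
Qed.

Lemma computable_pred F : computable F -> computable (fun v => (F v).-1).
Proof.
move=> cF.
apply: (@computable_eq (fun v => nat_rect (fun=> nat) 0 (fun k z => k) (F v))).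
  by move=> v; case: (F v).
apply: computable_rec2 => //; first exact: computable_const.
exact: computable_nth.
Qed.

Lemma computable_add F G : computable F -> computable G ->
  computable (fun v => F v + G v).
Proof.
move=> cF cG.
apply: (@computable_eq (fun v => nat_rect (fun=> nat) (F v) (fun k z => z.+1) (G v))).
  by move=> v; elim: (G v) => [|k /= ->]; rewrite ?addn0 ?addnS.
apply: computable_rec2 => //; apply: computable_succ; exact: computable_nth.
Qed.

Lemma computable_sub F G : computable F -> computable G ->
  computable (fun v => F v - G v).
Proof.
move=> cF cG.
apply: (@computable_eq (fun v => nat_rect (fun=> nat) (F v) (fun k z => z.-1) (G v))).
  by move=> v; elim: (G v) => [|k /= ->]; rewrite ?subn0 ?subnS.
apply: computable_rec2 => //; apply: computable_pred; exact: computable_nth.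
Qed.

(** A bound variable is the new head of the list of arguments. *)
Lemma computable_sum B (F : nat -> seq nat -> nat) : computable B ->
  computable (fun w => F (nth 0 w 0) (behead w)) ->
  computable (fun v => \sum_(0 <= x < B v) F x v).
Proof.
move=> cB cF.
apply: (@computable_eq (fun v => nat_rect (fun=> nat) 0 (fun k z => z + F k v) (B v))).
  by move=> v; elim: (B v) => [|k /= ->]; [rewrite big_geq|rewrite big_nat_recr].
apply: computable_rec2 => //; first exact: computable_const.
apply: computable_add; first exact: computable_nth.
apply: (computable_eq _ (computable_cons_drop 2 cF (computable_nth 0))).
by move=> w /=; rewrite -!drop1 drop_drop.
Qed.

Lemma computable_mul F G : computable F -> computable G ->
  computable (fun v => F v * G v).
Proof.
move=> cF cG.
apply: (@computable_eq (fun v => \sum_(0 <= x < G v) F v)).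
  by move=> v; rewrite sum_nat_const_nat subn0 mulnC.
exact: computable_sum cG (computable_behead cF).
Qed.

Lemma computable_expn F G : computable F -> computable G ->
  computable (fun v => F v ^ G v).
Proof.
move=> cF cG.
apply: (@computable_eq (fun v => nat_rect (fun=> nat) 1 (fun k z => z * F v) (G v))).
  by move=> v; elim: (G v) => [//|k /= ->]; rewrite expnS mulnC.
apply: computable_rec2 => //; first exact: computable_const.
apply: computable_mul; first exact: computable_nth.
exact: computable_behead (computable_behead cF).
Qed.

(** Decidable predicates are identified with their 0/1-valued characteristic
    functions. *)
Notation decidable_pred P := (computable (fun v => nat_of_bool (P v))).

Lemma computable_if (b : seq nat -> bool) F G : decidable_pred b ->
  computable F -> computable G -> computable (fun v => if b v then F v else G v).
Proof.
move=> cb cF cG.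
apply: (@computable_eq (fun v => nat_rect (fun=> nat) (G v) (fun k z => F v) (b v))).
  by move=> v; case: (b v).
by apply: computable_rec2 => //; exact: computable_behead (computable_behead cF).
Qed.

Lemma computable_leq F G : computable F -> computable G ->
  decidable_pred (fun v => F v <= G v).
Proof.
move=> cF cG.
apply: (@computable_eq (fun v => 1 - (F v - G v))).
  by move=> v; case: leqP; lia.
apply: computable_sub; first exact: computable_const.
exact: computable_sub.
Qed.

Lemma computable_negb (b : seq nat -> bool) : decidable_pred b ->
  decidable_pred (fun v => ~~ b v).
Proof.
move=> cb; apply: (@computable_eq (fun v => 1 - b v)); first by move=> v; case: (b v).
exact: computable_sub (computable_const 1) cb.
Qed.

Lemma computable_andb (b c : seq nat -> bool) : decidable_pred b ->
  decidable_pred c -> decidable_pred (fun v => b v && c v).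
Proof.
move=> cb cc; apply: (@computable_eq (fun v => b v * c v)).
  by move=> v; rewrite mulnb.
exact: computable_mul.
Qed.

Lemma computable_orb (b c : seq nat -> bool) : decidable_pred b ->
  decidable_pred c -> decidable_pred (fun v => b v || c v).
Proof.
move=> cb cc; apply: (@computable_eq (fun v => ~~ (~~ b v && ~~ c v))).
  by move=> v; rewrite negb_and !negbK.
by apply/computable_negb/computable_andb; exact/computable_negb.
Qed.

Lemma computable_eqn F G : computable F -> computable G ->
  decidable_pred (fun v => F v == G v).
Proof.
move=> cF cG.
apply: (@computable_eq (fun v => (F v <= G v) && (G v <= F v))).
  by move=> v; rewrite -eqn_leq.
by apply: computable_andb; exact: computable_leq.
Qed.

Lemma computable_all B (P : nat -> seq nat -> bool) : computable B ->
  decidable_pred (fun w => P (nth 0 w 0) (behead w)) ->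
  decidable_pred (fun v => all (fun x => P x v) (iota 0 (B v))).
Proof.
move=> cB cP.
apply: (@computable_eq (fun v => \sum_(0 <= x < B v) ~~ P x v == 0)); last first.
  apply: computable_eqn (computable_const 0); apply: computable_sum => //.
  exact: computable_negb.
move=> v; congr nat_of_bool; rewrite sum_nat_seq_eq0 /index_iota subn0.
by apply: eq_all => x /=; rewrite eqb0 negbK.
Qed.

Lemma computable_has B (P : nat -> seq nat -> bool) : computable B ->
  decidable_pred (fun w => P (nth 0 w 0) (behead w)) ->
  decidable_pred (fun v => has (fun x => P x v) (iota 0 (B v))).
Proof.
move=> cB cP.
apply: (@computable_eq (fun v => ~~ all (fun x => ~~ P x v) (iota 0 (B v)))).
  move=> v; rewrite -has_predC; congr nat_of_bool.
  by apply: eq_has => x /=; rewrite negbK.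
apply/computable_negb/computable_all => //; exact: computable_negb.
Qed.

(** The first solution is the number of candidates below the bound that have no
    solution up to them. *)
Lemma computable_find B (P : nat -> seq nat -> bool) : computable B ->
  decidable_pred (fun w => P (nth 0 w 0) (behead w)) ->
  computable (fun v => find (fun x => P x v) (iota 0 (B v))).
Proof.
move=> cB cP.
pose Q x (v : seq nat) := ~~ has (fun x => P x v) (iota 0 x.+1).
apply: (@computable_eq (fun v => \sum_(0 <= x < B v) Q x v)).
  move=> v; elim: (B v) => [|b IH]; first by rewrite big_geq.
  rewrite big_nat_recr // IH -addn1 iotaD find_cat size_iota add0n.
  rewrite /Q -addn1 iotaD has_cat /= add0n orbF.
  case: ifP => /= hN; first by rewrite addn0.
  by rewrite (hasNfind (negbT hN)) size_iota; case: (P b v).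
apply: computable_sum => //; apply: computable_negb.
apply: (@computable_has (fun w => (nth 0 w 0).+1)
  (fun x w => P x (behead w))); first exact/computable_succ/computable_nth.
apply: (computable_eq _ (computable_cons_drop 2 cP (computable_nth 0))).
by move=> w /=; rewrite -!drop1 drop_drop.
Qed.

Lemma computable_divn F G : computable F -> computable G ->
  computable (fun v => F v %/ G v).
Proof.
move=> cF cG.
apply: (@computable_eq (fun v => if G v == 0 then 0 else
    find (fun q => F v < q.+1 * G v) (iota 0 (F v).+1))).
  move=> v; case: eqP => [->|/eqP]; first by rewrite divn0.
  rewrite -lt0n => G_gt0; have /andP[lo hi] : F v %/ G v * G v <= F v < (F v %/ G v).+1 * G v.
    by rewrite leq_divM ltn_ceil.
  have hasq : has (fun q => F v < q.+1 * G v) (iota 0 (F v).+1).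
    apply/hasP; exists (F v %/ G v) => //.
    by rewrite mem_iota add0n ltnS leq_div.
  have := nth_find 0 hasq; have := before_find 0 (a := fun q => F v < q.+1 * G v) (s := iota 0 (F v).+1).
  move: hasq; rewrite has_find size_iota; set q := find _ _ => ltq minq.
  rewrite nth_iota // add0n => ubq.
  apply/eqP; rewrite eqn_leq; apply/andP; split.
    rewrite leqNgt; apply/negP => /[dup] ltdq /minq.
    rewrite nth_iota; last exact: ltn_trans ltdq ltq.
    by rewrite add0n hi.
  by rewrite -ltnS ltn_divLR.
apply: computable_if; first exact: computable_eqn cG (computable_const 0).
  exact: computable_const.
apply: computable_find; first exact: computable_succ.
apply: computable_leq; first exact/computable_succ/computable_behead.
apply: computable_mul; last exact: computable_behead.
exact/computable_succ/computable_nth.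
Qed.

Lemma computable_modn F G : computable F -> computable G ->
  computable (fun v => F v %% G v).
Proof.
move=> cF cG; apply: (@computable_eq (fun v => F v - F v %/ G v * G v)).
  by move=> v; rewrite {1}(divn_eq (F v) (G v)) addKn.
by apply: computable_sub => //; apply: computable_mul => //; exact: computable_divn.
Qed.

Lemma computable_odd F : computable F -> decidable_pred (fun v => odd (F v)).
Proof.
move=> cF; apply: (@computable_eq (fun v => F v %% 2)); first by move=> v; rewrite modn2.
exact: computable_modn cF (computable_const 2).
Qed.

(** Decides [computable] goals by structural descent; leaves the goals that
    are about a function given by name. *)
Ltac computability :=
  repeat match goal with
  | _ => assumption
  | |- computable (fun v => nth 0 v _) => apply: computable_nth
  | |- computable (fun _ => ?c) => apply: (computable_const c)
  | |- computable (fun v => nth 0 (behead (@?g v)) ?i) =>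
      refine (@computable_nth_behead g i _)
  | |- computable (fun v => ?F (behead v)) => apply: (@computable_behead F)
  | |- computable (fun v => ?F (behead (behead v))) =>
      refine (@computable_behead (fun v => F (behead v)) _)
  | |- computable (fun v => ?F (behead (behead (behead v)))) =>
      refine (@computable_behead (fun v => F (behead (behead v))) _)
  | |- computable (fun v => ?F (behead (behead (behead (behead v))))) =>
      refine (@computable_behead (fun v => F (behead (behead (behead v)))) _)
  | |- computable (fun v => (@?F v).+1) => apply: (@computable_succ F)
  | |- computable (fun v => (@?F v).-1) => apply: (@computable_pred F)
  | |- computable (fun v => @?F v + @?G v) => apply: (@computable_add F G)
  | |- computable (fun v => @?F v - @?G v) => apply: (@computable_sub F G)
  | |- computable (fun v => @?F v * @?G v) => apply: (@computable_mul F G)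
  | |- computable (fun v => @?F v ^ @?G v) => apply: (@computable_expn F G)
  | |- computable (fun v => @?F v %/ @?G v) => apply: (@computable_divn F G)
  | |- computable (fun v => @?F v %% @?G v) => apply: (@computable_modn F G)
  | |- computable (fun v => nat_of_bool (@?F v <= @?G v)) =>
      apply: (@computable_leq F G)
  | |- computable (fun v => nat_of_bool (@?F v == @?G v)) =>
      apply: (@computable_eqn F G)
  | |- computable (fun v => nat_of_bool (@?F v && @?G v)) =>
      apply: (@computable_andb F G)
  | |- computable (fun v => nat_of_bool (@?F v || @?G v)) =>
      apply: (@computable_orb F G)
  | |- computable (fun v => nat_of_bool (odd (@?F v))) => apply: (@computable_odd F)
  | |- computable (fun v => nat_of_bool (~~ @?F v)) => apply: (@computable_negb F)
  | |- computable (fun v => match _ with true => _ | false => _ end) =>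
      apply: computable_if
  | |- computable (fun v => nat_of_bool (all _ _)) => apply: computable_all
  | |- computable (fun v => nat_of_bool (has _ _)) => apply: computable_has
  | |- computable (fun v => find _ _) => apply: computable_find
  | |- computable (fun v => \sum_(0 <= x < _) _) => apply: computable_sum
  end.

(** * Evaluation with bounded resources *)

(** [run e s v] is [0] as long as the computation of [e] on [v] has not
    converged with resources [s], and [y.+1] once it has converged to [y]. *)
Fixpoint run n (e : recfun n) (s : nat) (v : seq nat) : nat :=
  match e with
  | Zero _ => 1
  | Succ => (nth 0 v 0).+2
  | Proj _ i => (nth 0 v i).+1
  | Comp m _ f g =>
      if all (fun i => 0 < run (g i) s v) (enum 'I_m)
      then run f s [seq (run (g i) s v).-1 | i <- enum 'I_m] else 0
  | Prec _ f g =>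
      nat_rect (fun=> nat) (run f s (behead v))
        (fun k z => if z == 0 then 0 else run g s [:: k, z.-1 & behead v])
        (nth 0 v 0)
  | Mu _ f =>
      let y := find (fun y => run f s (y :: v) <= 1) (iota 0 s) in
      if (y < s) && (run f s (y :: v) == 1) then y.+1 else 0
  end.

Lemma find_iotaP (p : pred nat) s y : y < s -> p y ->
  (forall k, k < y -> ~~ p k) -> find p (iota 0 s) = y.
Proof.
move=> ys py min_y.
have hasp : has p (iota 0 s) by apply/hasP; exists y; rewrite // mem_iota.
have := nth_find 0 hasp; have := before_find 0 (a := p) (s := iota 0 s).
move: hasp; rewrite has_find size_iota; set q := find _ _ => ltq minq.
rewrite nth_iota // add0n => pq; apply/eqP; rewrite eqn_leq.
apply/andP; split; rewrite leqNgt; apply/negP.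
  move=> /[dup] ltyq /minq; rewrite nth_iota ?add0n ?py //.
by move=> /min_y; rewrite pq.
Qed.

Lemma find_iota_lt (p : pred nat) s : find p (iota 0 s) < s ->
  p (find p (iota 0 s)) /\ forall k, k < find p (iota 0 s) -> ~~ p k.
Proof.
move=> lts; have hasp : has p (iota 0 s) by rewrite has_find size_iota.
split; first by have := nth_find 0 hasp; rewrite nth_iota.
move=> k ltk; have := before_find 0 ltk.
by rewrite nth_iota ?add0n => [->|]; last exact: ltn_trans lts.
Qed.

Lemma run_mono n (e : recfun n) s s' v y : s <= s' ->
  run e s v = y.+1 -> run e s' v = y.+1.
Proof.
move=> les; elim: e v y => {n} [n||n i|m n f IHf g IHg|n f IHf g IHg|n f IHf] v y //=.
- case: ifP => // /allP allg runf.
  have gE i : run (g i) s' v = run (g i) s v.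
    have := allg i (mem_enum _ i); case E : (run (g i) s v) => [//|z] _.
    exact: IHg E.
  have -> : all (fun i => 0 < run (g i) s' v) (enum 'I_m).
    by apply/allP => i /allg; rewrite gE.
  by under eq_map do rewrite gE; exact: IHf.
- elim: (nth 0 v 0) y => [|k IH] y /=; first exact: IHf.
  case: eqP => // /eqP; rewrite -lt0n.
  case E : (nat_rect _ _ _ k) => [//|z] _ /= runk.
  by rewrite (IH _ E) /=; exact: IHg.
- case: ifP => // /andP[lts /eqP run0] [<-].
  have [_ minq] := find_iota_lt lts; set q := find _ _ in lts run0 minq *.
  have run0' := IHf _ _ run0.
  have -> : find (fun y => run f s' (y :: v) <= 1) (iota 0 s') = q.
    apply: find_iotaP => [||k /minq]; first exact: leq_trans les.
      by rewrite run0'.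
    rewrite -!ltnNge; case E : (run f s (k :: v)) => [//|z].
    by rewrite (IHf _ _ E).
  by rewrite run0' (leq_trans lts les).
Qed.

Lemma runP n (e : recfun n) (v : n.-tuple nat) y :
  recfun_eval e v y <-> exists s, run e s v = y.+1.
Proof.
elim: e v y => {n} [n||n i|m n f IHf g IHg|n f IHf g IHg|n f IHf] v y /=.
- by split=> [->|[_ [<-]]]; first by exists 0.
- rewrite /thead (tnth_nth 0) /=.
  by split=> [->|[_ [<-]]]; first by exists 0.
- rewrite (tnth_nth 0).
  by split=> [->|[_ [<-]]]; first by exists 0.
- split=> [[w gw /IHf[sf runf]]|[s]].
    have /boolp.choice [sg Hsg] : forall i, exists s, run (g i) s v = (tnth w i).+1.
      by move=> i; apply/IHg.
    pose s := maxn sf (\max_i sg i); exists s.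
    have runi i : run (g i) s v = (tnth w i).+1.
      apply: run_mono (Hsg i); rewrite leq_max; apply/orP; right.
      exact: leq_bigmax.
    have -> : all (fun i => 0 < run (g i) s v) (enum 'I_m).
      by apply/allP => i _; rewrite runi.
    have -> : [seq (run (g i) s v).-1 | i <- enum 'I_m] = w.
      rewrite -[RHS](map_tnth_enum w) /=.
      by apply: eq_map => i; rewrite runi.
    by apply: run_mono runf; rewrite leq_maxl.
  case: ifP => // /allP allg runf.
  exists [tuple (run (g i) s v).-1 | i < m].
    move=> i; rewrite tnth_mktuple; apply/IHg; exists s.
    by rewrite prednK // allg ?mem_enum.
  by apply/IHf; exists s; rewrite -runf.
- have recE k z : prim_rec (recfun_eval f) (recfun_eval g) [tuple of behead v] k z <->
      exists s, nat_rect (fun=> nat) (run f s (behead v)) (fun k z =>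
        if z == 0 then 0 else run g s [:: k, z.-1 & behead v]) k = z.+1.
    have mono k' s s' z' : s <= s' ->
        run (Prec f g) s (k' :: behead v) = z'.+1 ->
        run (Prec f g) s' (k' :: behead v) = z'.+1 by exact: run_mono.
    elim: k z => [|k IH] z /=; first exact: IHf.
    split=> [[z' /IH[s1 run1] /IHg[s2 run2]]|[s]].
      exists (maxn s1 s2).
      have /= -> /= := mono k _ _ _ (leq_maxl s1 s2) run1.
      exact: run_mono (leq_maxr _ _) run2.
    case: eqP => // /eqP; rewrite -lt0n.
    case E : (nat_rect _ _ _ k) => [//|z'] _ /= runk.
    by exists z'; [apply/IH; exists s|apply/IHg; exists s].
  rewrite /thead (tnth_nth 0); exact: recE.
- split=> [[/IHf[s0 run0] ltk]|[s]].
    have /boolp.choice [sg Hsg] : forall k : 'I_y, exists s z, run f s [:: val k & val v] = z.+2.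
      by move=> k; have [z /IHf[s Hs]] := ltk k (ltn_ord k); exists s, z.
    pose s := maxn y.+1 (maxn s0 (\max_i sg i)).
    have runy : run f s (y :: v) = 1.
      by apply: run_mono run0; rewrite /s; lia.
    exists s.
    have -> : find (fun y => run f s (y :: v) <= 1) (iota 0 s) = y.
      apply: find_iotaP; rewrite ?runy //; first by rewrite /s; lia.
      move=> k lty; have [z Hz] := Hsg (Ordinal lty).
      rewrite (run_mono _ Hz) // /s.
      have := leq_bigmax (F := sg) (Ordinal lty); lia.
    by rewrite runy /= andbT leq_max leqnn.
  case: ifP => // /andP[lts /eqP run0] [<-].
  have [_ minq] := find_iota_lt lts; set q := find _ _ in lts run0 minq *.
  split; first by apply/IHf; exists s.
  move=> k /minq; rewrite -ltnNge => ltrun.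
  exists (run f s (k :: v)).-2; apply/IHf; exists s => /=; lia.
Qed.

(** For a fixed [e] the evaluator is primitive recursive, by induction on
    [e]. *)
Lemma computable_run n (e : recfun n) :
  computable (fun w => run e (nth 0 w 0) (behead w)).
Proof.
elim: e => {n} [n||n i|m n f IHf g IHg|n f IHf g IHg|n f IHf] /=.
- exact: computable_const.
- by computability.
- by computability.
- apply: computable_if.
  + elim: (enum 'I_m) => [|i s IH] /=; first exact: computable_const.
    by apply: computable_andb => //; computability.
  + pose Gs := [seq (fun w => (run (g i) (nth 0 w 0) (behead w)).-1) | i <- enum 'I_m].
    apply: (@computable_eq (fun w => run f (nth 0 (nth 0 w 0 :: [seq G w | G <- Gs]) 0)
        (behead (nth 0 w 0 :: [seq G w | G <- Gs])))).
      by move=> w /=; rewrite -map_comp.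
    apply: (@computable_comp (fun l => run f (nth 0 l 0) (behead l))
      ((fun w => nth 0 w 0) :: Gs)) => //.
    case=> [_|i]; first exact: computable_nth.
    rewrite /= size_map size_enum_ord ltnS => lti /=.
    rewrite (nth_map (Ordinal lti)) ?size_enum_ord //.
    exact: computable_pred.
  + exact: computable_const.
- apply: computable_rec2; first by computability.
    apply: (@computable_reindex 2 _ [:: fun w => nth 0 w 0] _ IHf).
      by case=> //= _; exact: computable_nth.
    by case=> [|a [|b w]] //=; rewrite drop0.
  apply: computable_if; [by computability|by computability|].
  apply: (@computable_reindex 4 _
    [:: fun w => nth 0 w 2; fun w => nth 0 w 0; fun w => (nth 0 w 1).-1] _ IHg).
    by case=> [|[|[|]]] //= _; computability.
  by case=> [|a [|b [|c [|d w]]]] //=; rewrite drop0.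
- have cf : computable (fun w => run f (nth 0 w 1) (nth 0 w 0 :: behead (behead w))).
    apply: (@computable_reindex 2 _ [:: fun w => nth 0 w 1; fun w => nth 0 w 0] _ IHf).
      by case=> [|[|]] //= _; computability.
    by case=> [|a [|b w]] //=; rewrite drop0.
  have cfind : computable (fun w =>
      find (fun y => run f (nth 0 w 0) (y :: behead w) <= 1) (iota 0 (nth 0 w 0))).
    apply: computable_find; first by computability.
    apply: computable_leq; last by computability.
    by apply: computable_eq cf => w; rewrite nth_behead.
  apply: computable_if; [apply: computable_andb|..]; [by computability| |by computability|by computability].
  apply: computable_eqn; last by computability.
  apply: (computable_eq _ (computable_cons_drop 0 cf cfind)) => w /=.
  by rewrite drop0.
Qed.

(** * Strings, codes and prefix-free machines *)

Fixpoint strdec_rec (n c : nat) : bitseq :=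
  if n is n'.+1 then
    if c is c'.+1 then odd c' :: strdec_rec n' c'./2 else [::]
  else [::].

Definition strdec c := strdec_rec c c.

Lemma strdecK : cancel strdec strcode.
Proof.
move=> c; rewrite /strdec.
suff H n c' : c' <= n -> strcode (strdec_rec n c') = c' by exact: H.
elim: n c' => [|n IH] [|c'] //= lec.
rewrite IH; last by lia.
by rewrite addnC odd_double_half.
Qed.

Lemma strcode_inj : injective strcode.
Proof.
elim=> [|b u IH] [|b' v] //= [] E.
have {}IH : strcode u = strcode v -> u = v by exact: IH.
by move: E; case: b; case: b' => /= E; [congr cons; apply: IH| | |congr cons; apply: IH]; lia.
Qed.

Lemma strcodeK : cancel strcode strdec.
Proof. by move=> u; apply: strcode_inj; rewrite strdecK. Qed.

Lemma strcode_cat u v : strcode (u ++ v) = strcode u + 2 ^ size u * strcode v.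
Proof.
elim: u => [|b u IH] /=; first by rewrite mul1n.
rewrite IH expnS; lia.
Qed.

Lemma strcode_size u : 2 ^ size u <= (strcode u).+1 < 2 ^ (size u).+1.
Proof.
elim: u => [//|b u IH] /=; rewrite !expnS in IH *; case: b => /=; lia.
Qed.

Lemma leq_strcode_size u v : strcode u <= strcode v -> size u <= size v.
Proof.
move=> le; rewrite leqNgt; apply/negP => lts.
have /andP[_ hi] := strcode_size v; have /andP[lo _] := strcode_size u.
have : 2 ^ (size v).+1 <= 2 ^ size u by rewrite leq_exp2l.
lia.
Qed.

Lemma strcode_nseq0 n : (strcode (nseq n false)).+1 = 2 ^ n.
Proof. by elim: n => [//|n IH] /=; rewrite expnS; lia. Qed.

Lemma strcode_cat_nseq0 u n :
  strcode (u ++ nseq n false) = strcode u + 2 ^ size u * (2 ^ n).-1.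
Proof. by rewrite strcode_cat; congr (_ + _ * _); rewrite -strcode_nseq0. Qed.

(** The length of the string with code [c]; only this form is visibly
    computable. *)
Definition strlen c := \sum_(0 <= i < c) (2 ^ i.+1 <= c.+1).

Lemma strlenE u : strlen (strcode u) = size u.
Proof.
have /andP[lo hi] := strcode_size u.
have ltsc : size u <= strcode u by have := ltn_expl (size u) (ltnSn 1); lia.
rewrite /strlen (big_cat_nat _ (n := size u)) //=.
rewrite (eq_big_nat _ _ (F2 := fun=> 1)); last first.
  move=> i /andP[_ lti]; rewrite (leq_trans _ lo) //.
  by rewrite leq_exp2l.
rewrite sum_nat_const_nat subn0 muln1 big_nat_cond big1 ?addn0 //.
move=> i /andP[/andP[lei _] _]; apply/eqP; rewrite eqb0 -ltnNge.
by rewrite (leq_trans hi) // leq_exp2l.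
Qed.

Lemma computable_strlen F : computable F -> computable (fun v => strlen (F v)).
Proof. by move=> cF; rewrite /strlen; computability. Qed.

(** The run of zeros makes the code self-delimiting at the price of [a.+1]
    bits. *)
Definition header a w : bitseq := nseq a false ++ true :: w.

Lemma size_header a w : size (header a w) = a + (size w).+1.
Proof. by rewrite size_cat size_nseq. Qed.

Lemma strcode_header a w :
  (strcode (header a w)).+1 = 2 ^ a * (2 * strcode w + 3).
Proof.
elim: a => [|a IH] /=; first by rewrite mul1n; lia.
by rewrite -/(header a w) expnS -mulnA -IH; lia.
Qed.

Lemma header_prefix a b u v : prefix (header a u) (header b v) ->
  a = b /\ prefix u v.
Proof.
elim: a b => [|a IH] [|b] //=; last first.
  by move=> /IH [-> ->].
Qed.

Lemma search_machine (P : nat -> nat -> bool) (out : nat -> nat -> nat) :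
  decidable_pred (fun w => P (nth 0 w 0) (nth 0 w 1)) ->
  computable (fun w => out (nth 0 w 0) (nth 0 w 1)) ->
  exists M, [/\ partial_computable M,
    (forall t, M t <> None -> exists s, P s (strcode t)) &
    forall t s, P s (strcode t) -> (forall s', s' < s -> ~~ P s' (strcode t)) ->
      M t = Some (strdec (out s (strcode t)))].
Proof.
move=> cP cout.
have [eP HP] := computable_negb cP 2; have [eO HO] := cout 2.
pose M t := if pselect (exists s, P s (strcode t)) is left ex
            then Some (strdec (out (ex_minn ex) (strcode t))) else None.
have ME t s : P s (strcode t) -> (forall s', s' < s -> ~~ P s' (strcode t)) ->
    M t = Some (strdec (out s (strcode t))).
  rewrite /M => Ps mins; case: pselect => [ex|[]]; last by exists s.
  case: ex_minnP => m Pm minm; suff -> : m = s by [].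
  apply/eqP; rewrite eqn_leq minm //= leqNgt.
  by apply/negP => /mins; rewrite Pm.
exists M; split=> //; last first.
  by move=> t; rewrite /M; case: pselect.
exists (Comp eO (fun i : 'I_2 => if i == ord0 then Mu eP else Proj ord0)) => t y /=.
have muE x s : recfun_eval (Mu eP) [tuple x] s <->
    P s x /\ forall s', s' < s -> ~~ P s' x.
  split=> [[/HP /= H1 H2]|[H1 H2]] /=.
    split; first by move: H1; case: (P s x).
    by move=> s' /H2 [z /HP /=]; case: (P s' x).
  split; first by apply/HP; rewrite /= H1.
  by move=> s' /H2 nP; exists 0; apply/HP; rewrite /= nP.
split.
  move=> [w wE /HO ->].
  have /muE[P1 P2] := wE ord0.
  have /= := wE (lift ord0 ord0); rewrite !(tnth_nth 0) /= => w1.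
  rewrite (tnth_nth 0) /= in P1 P2.
  exists (strdec (out (nth 0 w 0) (strcode t))); first exact: ME.
  by rewrite strdecK w1.
move=> [u]; rewrite {1}/M; case: pselect => // ex [<-] ->.
case: ex_minnP => m Pm minm; exists [tuple m; strcode t].
  move=> i; case: eqP => [->|ne].
    apply/muE; rewrite (tnth_nth 0) /=; split=> // s'; rewrite ltnNge.
    by apply: contra => /minm.
  have -> : i = lift ord0 ord0.
    by apply: val_inj; case: i ne => -[|[|]] //= ? [] //; exact: val_inj.
  by rewrite /= !(tnth_nth 0).
by apply/HO; rewrite strdecK.
Qed.

(** The header determines the length [L a] of the payload, so the domain is
    prefix-free whatever [L] is; and since a search is allowed, the outputs can
    depend on what another machine has done so far. *)
Lemma header_machine (L : nat -> nat) (Q : nat -> nat -> nat -> bool)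
    (out : nat -> nat -> nat -> nat) :
  computable (fun w => L (nth 0 w 0)) ->
  decidable_pred (fun w => Q (nth 0 w 0) (nth 0 w 1) (nth 0 w 2)) ->
  computable (fun w => out (nth 0 w 0) (nth 0 w 1) (nth 0 w 2)) ->
  exists2 M, prefix_free_machine M & forall a w s, size w = L a ->
    Q s a (strcode w) -> (forall s', s' < s -> ~~ Q s' a (strcode w)) ->
    M (header a w) = Some (strdec (out s a (strcode w))).
Proof.
move=> cL cQ cout.
have cL' F : computable F -> computable (fun v => L (F v)).
  exact: computable_comp1.
have cQ' F G H : computable F -> computable G -> computable H ->
    decidable_pred (fun v => Q (F v) (G v) (H v)).
  move=> cF cG cH; apply: (@computable_reindex 0 _ [:: F; G; H] _ cQ) => //.
  by case=> [|[|[|]]].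
have cout' F G H : computable F -> computable G -> computable H ->
    computable (fun v => out (F v) (G v) (H v)).
  move=> cF cG cH; apply: (@computable_reindex 0 _ [:: F; G; H] _ cout) => //.
  by case=> [|[|[|]]].
pose D x a i := (x.+1 == 2 ^ a * (2 * i + 3)) && (strlen i == L a).
pose P s x := has (fun a => has (fun i => D x a i && Q s a i) (iota 0 x.+1)) (iota 0 x.+1).
pose out' s x := \sum_(0 <= a < x.+1) \sum_(0 <= i < x.+1) D x a i * out s a i.
have DP a i x : reflect (size (strdec i) = L a /\ x = strcode (header a (strdec i))) (D x a i).
  rewrite /D; have <- : (strcode (header a (strdec i))).+1 = 2 ^ a * (2 * i + 3).
    by rewrite strcode_header strdecK.
  have -> : strlen i = size (strdec i) by rewrite -strlenE strdecK.
  by rewrite eqSS; apply: (iffP andP) => [[/eqP-> /eqP->]|[-> ->]].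
have Dle a i x : D x a i -> (a < x.+1) && (i < x.+1).
  move=> /DP[_ ->]; rewrite strcode_header strdecK.
  have := ltn_expl a (ltnSn 1); nia.
have DU a i w : D (strcode (header a w)) a i -> i = strcode w.
  move=> /DP[_ /strcode_inj /eqP]; rewrite eqseq_cat // eqxx /= eqseq_cons eqxx /=.
  by move=> /eqP ->; rewrite strdecK.
have DUa a b i w : D (strcode (header a w)) b i -> a = b.
  move=> /DP[_ /strcode_inj E]; have : prefix (header a w) (header b (strdec i)).
    by rewrite E prefix_refl.
  by case/header_prefix.
have [||M [cM Mdom ME]] := @search_machine P out'.
- rewrite /P /D; computability; first by apply: computable_strlen; computability.
    by apply: cL'; computability.
  by apply: cQ'; computability.
- rewrite /out' /D; computability; first by apply: computable_strlen; computability.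
    by apply: cL'; computability.
  by apply: cout'; computability.
exists M.
  split=> // t u /Mdom [s /hasP[a _ /hasP[i _ /andP[/DP[szi /strcode_inj->] _]]]].
  move=> /Mdom [s' /hasP[b _ /hasP[j _ /andP[/DP[szj /strcode_inj->] _]]]].
  move=> /header_prefix [eab]; move: szj; rewrite -eab => szj.
  by rewrite prefixE szi -szj take_size => /eqP ->.
move=> a w s szw Qs mins.
have Dw : D (strcode (header a w)) a (strcode w).
  by apply/DP; rewrite strcodeK.
have PE s' : P s' (strcode (header a w)) = Q s' a (strcode w).
  apply/idP/idP.
    move=> /hasP[b _ /hasP[i _ /andP[Di]]].
    have Eb := DUa _ _ _ _ Di; rewrite -{}Eb in Di *.
    by rewrite (DU _ _ _ Di).
  move=> Qs'; have /andP[lta lti] := Dle _ _ _ Dw.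
  apply/hasP; exists a; first by rewrite mem_iota.
  by apply/hasP; exists (strcode w); rewrite ?mem_iota ?Dw.
rewrite (ME _ s) ?PE // => [|s' /mins]; last by rewrite PE.
congr (Some (strdec _)); rewrite /out'.
have /andP[lta lti] := Dle _ _ _ Dw.
rewrite (bigD1_seq a) ?mem_index_iota ?iota_uniq //= [X in _ + X]big1 ?addn0; last first.
  move=> b neb; rewrite big1 // => i _; case Di : (D _ b i) => //.
  by rewrite (DUa _ _ _ _ Di) eqxx in neb.
rewrite (bigD1_seq (strcode w)) ?mem_index_iota ?iota_uniq //= [X in _ + X]big1 ?addn0; last first.
  move=> i nei; case Di : (D _ a i) => //.
  by rewrite (DU _ _ _ Di) eqxx in nei.
by rewrite Dw mul1n.
Qed.

(** * Stages of a machine and the requests made to it *)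

(** Scale [b] has the grid of mesh [2^-scale_exp b]; the forbidden intervals at
    the right of its points have relative length [2^-gap_exp b]. *)
Definition scale_exp b : nat := (2 * b + 4) ^ 2.
Definition gap_exp b : nat := 3 * b + 2.
Definition scales_nb a : nat := 2 ^ (8 * a + 17).
Definition row_exp a : nat := scale_exp (a + scales_nb a).


(** The numerator of the dyadic rational [0.u], over [2 ^ size u]. *)
Fixpoint strval (u : bitseq) : nat :=
  if u is b :: u' then b * 2 ^ size u' + strval u' else 0.

Lemma strval_lt u : strval u < 2 ^ size u.
Proof. by elim: u => [//|b u IH] /=; rewrite expnS; case: b; lia. Qed.

Lemma strval_cat u v : strval (u ++ v) = strval u * 2 ^ size v + strval v.
Proof.
elim: u => [|b u IH] //=; rewrite IH size_cat expnD; lia.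
Qed.

Lemma strval_nseq0 n : strval (nseq n false) = 0.
Proof. by elim: n. Qed.

Lemma strval_inj u v : size u = size v -> strval u = strval v -> u = v.
Proof.
elim: u v => [|b u IH] [|b' v] //= [szuv]; rewrite szuv => E.
have ltu := strval_lt u; have ltv := strval_lt v; rewrite szuv in ltu.
have eqb : b = b' by move: E; case: (b); case: (b') => //=; lia.
by rewrite eqb (IH v) //; move: E; rewrite eqb; lia.
Qed.

Fixpoint bits (n v : nat) : bitseq :=
  if n is n'.+1 then (2 ^ n' <= v) :: bits n' (v %% 2 ^ n') else [::].

Lemma size_bits n v : size (bits n v) = n.
Proof. by elim: n v => //= n IH v; rewrite IH. Qed.

Lemma strval_bits n v : v < 2 ^ n -> strval (bits n v) = v.
Proof.
elim: n v => [|n IH] v /=; first by case: v.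
rewrite expnS => ltv; rewrite size_bits IH ?ltn_mod ?expn_gt0 //.
case: leqP => /= le; last by rewrite modn_small.
have := modnDr (v - 2 ^ n) (2 ^ n); rewrite subnK // => ->.
by rewrite modn_small; lia.
Qed.

(** Computable counterpart of [strval] on codes. *)
Definition codeval c := \sum_(0 <= i < strlen c) odd (c.+1 %/ 2 ^ i) * 2 ^ (strlen c - i.+1).

Lemma codevalE u : codeval (strcode u) = strval u.
Proof.
rewrite /codeval strlenE; elim: u => [|b u IH] /=; first by rewrite big_geq.
rewrite big_nat_recl //= expn0 divn1 subn1 /=.
rewrite !negbK oddD odd_double oddb /=; congr (_ + _); rewrite -IH !big_nat; apply: eq_bigr => i _.
rewrite subSS expnS divnMA; congr (odd (_ %/ _) * _); lia.
Qed.

Lemma computable_codeval F : computable F -> computable (fun v => codeval (F v)).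
Proof.
move=> cF; rewrite /codeval; have cL := computable_strlen cF.
by have cL1 := computable_behead cL; computability.
Qed.

Section Stages.
Variable e : recfun 1.

(** At stage [s] the programs and the outputs with code below [s] are taken
    into account. *)
Definition program s y := find (fun t => run e s [:: t] == y.+1) (iota 0 s).

Definition weight s y :=
  if program s y < s then 2 ^ (s - strlen (program s y)) else 0.

(** [2 ^ s] times the weight at stage [s] of the strings whose dyadic value is
    at most [v / 2 ^ r]. *)
Definition below s r v :=
  \sum_(0 <= y < s) (codeval y * 2 ^ r <= v * 2 ^ strlen y) * weight s y.

Lemma computable_program S Y : computable S -> computable Y ->
  computable (fun v => program (S v) (Y v)).
Proof.
move=> cS cY; rewrite /program; computability.
apply: (@computable_comp (fun l => run e (nth 0 l 0) (behead l))
  [:: fun w => S (behead w); fun w => nth 0 w 0]); first exact: computable_run.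
by case=> [|[|]] //= _; computability.
Qed.

Lemma computable_weight S Y : computable S -> computable Y ->
  computable (fun v => weight (S v) (Y v)).
Proof.
move=> cS cY; rewrite /weight; have cP := computable_program cS cY.
have cL := computable_strlen cP.
by computability.
Qed.

Lemma computable_below S A B : computable S -> computable A -> computable B ->
  computable (fun v => below (S v) (A v) (B v)).
Proof.
move=> cS cA cB; rewrite /below.
have c0 : computable (fun w => nth 0 w 0) := computable_nth 0.
have cV := computable_codeval c0; have cL := computable_strlen c0.
have cW := computable_weight (computable_behead cS) c0.
by computability.
Qed.

Variable sigma : bitseq.

(** The boundaries of the row are the dyadic rationals of level [row_exp a] in
    the cone of [sigma]; they are numbered from [row_start a]. *)
Definition row_len a := 2 ^ (row_exp a - size sigma).
Definition row_start a := strval sigma * row_len a.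
Definition boundary s a j := below s (row_exp a) (row_start a + j).

Definition fine_row a s := all (fun j =>
    boundary s a j * 2 ^ (2 * a + 1 + row_exp a) + 2 ^ s <=
    boundary s a j.+1 * 2 ^ (2 * a + 1 + row_exp a)) (iota 0 (row_len a).-1).

(** The number [x] is [2 ^ s] times the distance from the boundary to the grid
    point on its left, in units of the mesh. Only the left half of the interval
    that random values avoid is forbidden to the approximations. *)
Definition clear_row a s := all (fun j => all (fun b =>
    let x := boundary s a j * 2 ^ scale_exp (a + b) %% 2 ^ s in
    (x == 0) || (2 ^ s < x * 2 ^ (gap_exp (a + b) + 1)))
  (iota 0 (scales_nb a))) (iota 0 (row_len a)).

Definition calm_row a s := fine_row a s && clear_row a s.

(** The string of [m] zeros has got the weight that was requested for it. The
    first condition ensures that the string already counts in [below] at stage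
    [s], where only outputs with code less than [s] do. *)
Definition served a s m := (2 ^ m <= s) &&
  (2 ^ s <= weight s (2 ^ m).-1 * 2 ^ (2 * a + 1 + row_exp a)).

(** A new request is made as soon as the last one has been served and the row
    is calm; [last_request a s] is [k.+1] when the last request before stage
    [s] was made at stage [k]. *)
Definition last_request a s := nat_rect (fun=> nat) 0
  (fun k z => if calm_row a k && ((z == 0) || served a k z.-1) then k.+1 else z) s.

Definition request a s :=
  calm_row a s && ((last_request a s == 0) || served a s (last_request a s).-1).

Definition requests a s := \sum_(0 <= k < s) request a k.

Lemma computable_row_exp F : computable F -> computable (fun v => row_exp (F v)).
Proof. by move=> cF; rewrite /row_exp /scale_exp /scales_nb; computability. Qed.

Lemma computable_boundary S A J : computable S -> computable A -> computable J ->
  computable (fun v => boundary (S v) (A v) (J v)).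
Proof.
move=> cS cA cJ; rewrite /boundary /row_start /row_len.
have cR := computable_row_exp cA.
by apply: computable_below => //; computability.
Qed.

Lemma computable_calm_row A S : computable A -> computable S ->
  decidable_pred (fun v => calm_row (A v) (S v)).
Proof.
move=> cA cS; rewrite /calm_row /fine_row /clear_row /row_len /scale_exp /gap_exp /scales_nb.
have cR := computable_row_exp cA.
have c0 : computable (fun w => nth 0 w 0) := computable_nth 0.
have cA1 := computable_behead cA; have cS1 := computable_behead cS.
have cA2 := computable_behead cA1; have cS2 := computable_behead cS1.
have cB0 := computable_boundary cS1 cA1 c0.
have cB1 := computable_boundary cS1 cA1 (computable_succ c0).
have cB2 := computable_boundary cS2 cA2 (computable_behead c0).
have cR1 := computable_behead cR.
by rewrite /=; computability.
Qed.

Lemma computable_served A S M : computable A -> computable S -> computable M ->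
  decidable_pred (fun v => served (A v) (S v) (M v)).
Proof.
move=> cA cS cM; rewrite /served; have cR := computable_row_exp cA.
have cW : computable (fun v => weight (S v) (2 ^ M v).-1).
  by apply: computable_weight => //; computability.
by computability.
Qed.

Lemma computable_last_request A S : computable A -> computable S ->
  computable (fun v => last_request (A v) (S v)).
Proof.
move=> cA cS; apply: computable_rec2 => //; first exact: computable_const.
have c0 := computable_nth 0; have c1 := computable_nth 1.
have cA2 := computable_behead (computable_behead cA).
have cC := computable_calm_row cA2 c0.
have cV := computable_served cA2 c0 (computable_pred c1).
by computability.
Qed.

Lemma computable_request A S : computable A -> computable S ->
  decidable_pred (fun v => request (A v) (S v)).
Proof.
move=> cA cS; rewrite /request.
have cL := computable_last_request cA cS.
have cC := computable_calm_row cA cS.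
have cV := computable_served cA cS (computable_pred cL).
by computability.
Qed.

Lemma computable_requests A S : computable A -> computable S ->
  computable (fun v => requests (A v) (S v)).
Proof.
move=> cA cS; rewrite /requests.
have cQ := computable_request (computable_behead cA) (computable_nth 0).
by computability.
Qed.

Lemma last_request_recent a k s : request a k -> k < s ->
  (forall k', k < k' < s -> ~~ (calm_row a k' && served a k' k)) ->
  last_request a s = k.+1.
Proof.
move=> rk; elim: s => // s IH; rewrite ltnS leq_eqVlt => /orP[/eqP <- _|ltks quiet].
  by move: rk; rewrite /request /last_request /= => ->.
have lastE : last_request a s = k.+1.
  by apply: IH => // k' /andP[ltk lts]; rewrite quiet // ltk ltnW.
rewrite /last_request /= -/(last_request a s) lastE /=.
by have := quiet s; rewrite ltks leqnn => /(_ isT)/negbTE ->.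
Qed.

Lemma request_quiet a k s : request a k -> k < s ->
  (forall k', k < k' < s -> ~~ (calm_row a k' && served a k' k)) ->
  request a s = calm_row a s && served a s k.
Proof.
by move=> rk ltks quiet; rewrite /request (last_request_recent rk ltks quiet).
Qed.

Lemma requests_recent a k s : request a k -> k < s ->
  (forall k', k < k' < s -> ~~ (calm_row a k' && served a k' k)) ->
  requests a s = (requests a k).+1.
Proof.
move=> rk ltks quiet; rewrite /requests (big_cat_nat _ (n := k.+1)) //=.
rewrite big_nat_recr //= rk [X in _ + X]big_nat_cond [X in _ + X]big1 ?addn0 ?addn1 //.
move=> k' /andP[/andP[ltk lts] _].
apply/eqP; rewrite eqb0 (request_quiet rk ltk) ?quiet ?ltk //.
by move=> j /andP[ltj ltj']; rewrite quiet // ltj (ltn_trans ltj').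
Qed.

Lemma first_request a : (exists s, calm_row a s) ->
  exists s, request a s /\ requests a s = 0.
Proof.
move=> ex; case: (ex_minnP ex) => s cs mins; exists s.
have last0 k : k <= s -> last_request a k = 0.
  elim: k => // k IH ltk; rewrite /last_request /= -/(last_request a k) IH ?(ltnW ltk) //=.
  by case: ifP => // /andP[/mins]; rewrite leqNgt ltk.
split; first by rewrite /request cs last0 ?eqxx.
rewrite /requests big_nat_cond big1 // => k /andP[/andP[_ ltk] _].
apply/eqP; rewrite eqb0; apply/negP => /andP[/mins]; rewrite leqNgt ltk.
by [].
Qed.

Lemma next_request a k : request a k ->
  (exists s0, forall s, s0 <= s -> served a s k) ->
  (forall s0, exists2 s, s0 <= s & calm_row a s) ->
  exists s, [/\ k < s, request a s, requests a s = (requests a k).+1 & served a s k].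
Proof.
move=> rk [s0 late] cofinal.
have ex : exists s, (k < s) && (calm_row a s && served a s k).
  have [s les cs] := cofinal (maxn s0 k.+1); exists s.
  by rewrite cs late; lia.
case: (ex_minnP ex) => s /andP[ltks /andP[cs sv]] mins; exists s.
have quiet k' : k < k' < s -> ~~ (calm_row a k' && served a k' k).
  move=> /andP[ltk lts]; apply/negP => ck; have := mins k'.
  by rewrite ltk ck => /(_ isT); rewrite leqNgt lts.
split=> //; first by rewrite (request_quiet rk ltks quiet) cs.
exact: requests_recent.
Qed.

Lemma calm_request a s : request a s -> calm_row a s.
Proof. by case/andP. Qed.

(** Calm returns and requests are served, so the process does not stop before
    [n] requests. *)
Lemma request_sequence a n :
  (forall s0, exists2 s, s0 <= s & calm_row a s) ->
  (forall k, request a k -> requests a k < n ->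
     exists s0, forall s, s0 <= s -> served a s k) ->
  exists st : nat -> nat,
    (forall i, i <= n -> calm_row a (st i)) /\
    (forall i, i < n -> st i < st i.+1 /\ served a (st i.+1) (st i)).
Proof.
move=> cofinal serve.
suff [st [H1 H2]] : exists st : nat -> nat,
    (forall i, i <= n -> request a (st i) /\ requests a (st i) = i) /\
    (forall i, i < n -> st i < st i.+1 /\ served a (st i.+1) (st i)).
  by exists st; split=> // i /H1[/calm_request].
elim: n serve => [|n IH] serve.
  have [|s [rs s0]] := @first_request a.
    by have [s _ cs] := cofinal 0; exists s.
  by exists (fun=> s); split=> // i; rewrite leqn0 => /eqP ->.
have [k rk ltk|st [H1 H2]] := IH; first by apply: serve => //; exact: ltnW.
have [rn qn] := H1 n (leqnn n).
have qnS : requests a (st n) < n.+1 by rewrite qn.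
have [s [lts rs qs ss]] := next_request rn (serve _ rn qnS) cofinal.
exists (fun i => if i <= n then st i else s); split=> i.
  by rewrite leq_eqVlt ltnS => /orP[/eqP->|lei]; [rewrite ltnn qs qn|rewrite lei; exact: H1].
by move=> leiS; case: (ltngtP i n) => [/H2 //|ltni|-> //]; lia.
Qed.

(** A request made at stage [s] is for the string of [s] zeros. It is fresh,
    since its code is too large to count at stage [s], and it counts for every
    boundary, since its dyadic value is [0]. *)
Lemma push_machine : exists2 M, prefix_free_machine M &
  forall a s, request a s -> requests a s < 2 ^ row_exp a ->
    exists2 w, size w = row_exp a & M (header a w) = Some (nseq s false).
Proof.
have c0 := computable_nth 0; have c1 := computable_nth 1; have c2 := computable_nth 2.
pose Q s a i := request a s && (i.+1 == requests a s + 2 ^ row_exp a).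
have [|||M pM ME] := @header_machine row_exp Q (fun s a i => (2 ^ s).-1).
- exact: computable_row_exp.
- rewrite /Q; have cR := computable_row_exp c1; have cq := computable_request c1 c0.
  by have cn := computable_requests c1 c0; computability.
- by computability.
exists M => // a s rs ltr; pose w := strdec (requests a s + 2 ^ row_exp a).-1.
have p0 : 0 < 2 ^ row_exp a by rewrite expn_gt0.
have wE : (strcode w).+1 = requests a s + 2 ^ row_exp a by rewrite strdecK; lia.
have szw : size w = row_exp a.
  have /andP[lo hi] := strcode_size w; rewrite wE in lo hi.
  apply/eqP; rewrite eqn_leq; apply/andP; split; rewrite leqNgt; apply/negP => lt.
    have : 2 ^ (row_exp a).+1 <= 2 ^ size w by rewrite leq_exp2l.
    by rewrite expnS; lia.
  have : 2 ^ (size w).+1 <= 2 ^ row_exp a by rewrite leq_exp2l.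
  by lia.
exists w => //; rewrite (ME a w s szw).
- by rewrite -strcode_nseq0 /= strcodeK.
- by rewrite /Q rs wE eqxx.
- move=> s' lts; rewrite /Q wE; apply/negP => /andP[rs' /eqP E].
  have : requests a s' < requests a s; last by lia.
  rewrite {2}/requests (big_cat_nat _ (n := s'.+1)) //= big_nat_recr //= rs'.
  by rewrite -/(requests a s'); lia.
Qed.

End Stages.

(** Dyadic rationals with [L a] bits get descriptions that are short for the
    precision [L a + m a]. *)
Lemma padding_machine (L m : nat -> nat) :
  computable (fun w => L (nth 0 w 0)) -> computable (fun w => m (nth 0 w 0)) ->
  exists2 M, prefix_free_machine M & forall a w, size w = L a ->
    M (header a w) = Some (w ++ nseq (m a) false).
Proof.
move=> cL cm.
have [||M pM ME] := @header_machine L (fun _ _ _ => true)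
  (fun s a i => i + 2 ^ L a * (2 ^ m a).-1) cL.
- exact: (computable_const 1).
- have cL1 := computable_comp1 cL (computable_nth 1).
  by have cm1 := computable_comp1 cm (computable_nth 1); computability.
exists M => // a w szw; rewrite (ME a w 0) //.
by rewrite -szw -strcode_cat_nseq0 strcodeK.
Qed.

Local Open Scope ring_scope.

(** * The combinatorics of a row of blocks *)

Section Counting.
Variable R : realFieldType.
Implicit Types (x y u s : R) (f : nat -> R).

Lemma count_separated_le f u x y n : 0 <= u -> (forall i, (i < n)%N -> f i + u <= f i.+1) ->
  x <= y + u ->
  u * (count (fun i => x <= f i <= y) (iota 0 n))%:R <= y - x + u.
Proof.
move=> u0 fS xy; pose c i : R := (count (fun i => x <= f i <= y) (iota 0 i))%:R.
have cS i : c i.+1 = c i + (x <= f i <= y)%R%:R.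
  by rewrite /c -addn1 iotaD count_cat /= add0n addn0 natrD.
suff [] : u * c n <= y - x + u /\ (u * c n <= 0 \/ u * c n <= f n - x) by [].
elim: n fS => [|n IH] fS; first by rewrite /c mulr0; split; [lra|left].
have {}IH := IH (fun i lti => fS i (ltnW lti)); have fn := fS n (ltnSn n).
rewrite cS; case: (boolP (x <= f n <= y)) => [/andP[xf fy]|_]; last first.
  rewrite addr0; move: IH => [h1 h2]; split=> //.
  by case: h2 => h; [left|right; lra].
by rewrite mulrDr mulr1; move: IH => [h1 [h|h]]; (split; [|right]); lra.
Qed.

Lemma count_multiples_ge s x y n : 0 <= s -> 0 <= x -> y <= n%:R * s ->
  y - x - s <= s * (count (fun v => x <= v%:R * s < y) (iota 0 n))%:R.
Proof.
move=> s0 x0 yn.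
pose c i : R := (count (fun v => x <= v%:R * s < y) (iota 0 i))%:R.
have cS i : c i.+1 = c i + (x <= i%:R * s < y)%R%:R.
  by rewrite /c -addn1 iotaD count_cat /= add0n addn0 natrD.
have c0 i : 0 <= s * c i by rewrite mulr_ge0 ?ler0n.
suff [h|//] : n%:R * s - x - s <= s * c n \/ y - x - s <= s * c n by lra.
elim: n {yn} => [|n IH]; first by left; rewrite mul0r; have := c0 0; lra.
have cSn := cS n; have cn := c0 n.
rewrite cSn mulrDr -addn1 natrD mulrDl mul1r.
case: (leP x (n%:R * s)) => xz; case: (ltP (n%:R * s) y) => zy;
  rewrite /= ?mulr1 ?mulr0; case: IH => h; (left + right); lra.
Qed.

Lemma count_le1 (T : eqType) (p : pred T) (s : seq T) : uniq s ->
  (forall a b, a \in s -> b \in s -> p a -> p b -> a = b) -> (count p s <= 1)%N.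
Proof.
move=> us inj; rewrite leqNgt; apply/negP; rewrite -size_filter.
have : uniq [seq x <- s | p x] by exact: filter_uniq.
have mem z : z \in [seq x <- s | p x] -> p z && (z \in s) by rewrite mem_filter.
case: [seq x <- s | p x] mem => [|x [|y l]] //= mem /andP[].
have /andP[px xs] := mem x (mem_head _ _).
have /andP[py ys] := mem y (mem_behead (s := [:: x, y & l]) (mem_head _ _)).
by rewrite (inj x y) // mem_head.
Qed.

End Counting.

Section Row.
Variable R : realFieldType.
Implicit Types (c : nat -> R) (q s eps : R).

(** The blocks that can come to contain [q] while everything moves to the
    right by less than [s / 2]. *)
Definition reaches c s q j := (c j <= q) && (q - s / 2 < c j.+1).

(** Only the feeding of tiny blocks pays, so a grid point is useful when the
    other blocks that can reach it are negligible. *)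
Definition ready nb c s eps eta q :=
  [&& c 0 + s / 2 <= q, q < c nb &
   \sum_(0 <= j < nb | reaches c s q j && (eps / 2 < c j.+1 - c j)) (c j.+1 - c j)
     <= eta * s].

Lemma row_block nb c q : c 0 <= q -> q < c nb ->
  exists2 j, (j < nb)%N & c j <= q < c j.+1.
Proof.
elim: nb => [|nb IH] c0 cnb; first by have := le_lt_trans c0 cnb; rewrite ltxx.
case: (ltP q (c nb)) => [/(IH c0)[j ltj cj]|cq]; first by exists j; rewrite // ltnW.
by exists nb; rewrite // cq.
Qed.


Lemma increment_sum nb (c : nat -> R) :
  \sum_(0 <= j < nb) (c j.+1 - c j) = c nb - c 0.
Proof. by rewrite telescope_sumr. Qed.

(** In a phase, [b t j] is the position of the boundary [j] at time [t]. *)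
Section Phase.
Variables (nb len : nat) (b : nat -> nat -> R) (u eps s eta : R) (vs : seq nat).
Hypothesis u_ge0 : 0 <= u.
Hypothesis u_eps : u <= eps / 2.
Hypothesis s_gt0 : 0 < s.
Hypothesis eps_s : eps <= s.
Hypothesis eta2 : eta < 2^-1.
Hypothesis grow : forall t j, (t < len)%N -> (j < nb)%N ->
  b t j.+1 - b t j <= b t.+1 j.+1 - b t.+1 j.
Hypothesis row_ge0 : forall j, (j < nb)%N -> b 0 j <= b 0 j.+1.
Hypothesis push : forall t, (t < len)%N -> b t 0 + u <= b t.+1 0.
Hypothesis calm : forall t j (v : nat), (t <= len)%N -> (j <= nb)%N -> v \in vs ->
  ~ (v%:R * s < b t j <= v%:R * s + eps).
Hypothesis vs_uniq : uniq vs.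
Hypothesis vs_ready : forall v : nat, v \in vs -> ready nb (b 0) s eps eta (v%:R * s).

Let moved := b len nb - b 0 nb.
Let growth j := (b len j.+1 - b len j) - (b 0 j.+1 - b 0 j).

Lemma block_le t t' j : (t <= t')%N -> (t' <= len)%N -> (j < nb)%N ->
  b t j.+1 - b t j <= b t' j.+1 - b t' j.
Proof.
move=> + + ltj; elim: t' => [|t' IH]; first by rewrite leqn0 => /eqP ->.
rewrite leq_eqVlt ltnS => /orP[/eqP -> //|lett'] lt'.
by apply: le_trans (IH lett' (ltnW lt')) _; exact: grow.
Qed.

Lemma span_le t t' i j : (t <= t')%N -> (t' <= len)%N -> (i <= j)%N -> (j <= nb)%N ->
  b t j - b t i <= b t' j - b t' i.
Proof.
move=> lett' lt'; elim: j => [|j IH]; first by rewrite leqn0 => /eqP ->; rewrite !subrr.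
rewrite leq_eqVlt ltnS => /orP[/eqP ->|leij ltj]; first by rewrite !subrr.
have := block_le lett' lt' ltj; have := IH leij (ltnW ltj); lra.
Qed.

Lemma step_ge t j : (t < len)%N -> (j <= nb)%N -> b t j + u <= b t.+1 j.
Proof.
move=> ltt lej; have := push ltt.
have := span_le (leqnSn t) ltt (leq0n j) lej; lra.
Qed.

Lemma boundary_le t t' j : (t <= t')%N -> (t' <= len)%N -> (j <= nb)%N ->
  b t j <= b t' j.
Proof.
move=> + + ltj; elim: t' => [|t' IH]; first by rewrite leqn0 => /eqP ->.
rewrite leq_eqVlt ltnS => /orP[/eqP -> //|lett'] lt'.
have := step_ge lt' ltj; have := IH lett' (ltnW lt'); move: u_ge0; lra.
Qed.

Lemma moved_ge t j : (t <= len)%N -> (j <= nb)%N -> b t j - b 0 j <= moved.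
Proof.
move=> lt lej; have := span_le (leq0n t) lt lej (leqnn nb).
have := boundary_le lt (leqnn len) (leqnn nb); rewrite /moved; lra.
Qed.

Lemma growth_ge0 j : (j < nb)%N -> 0 <= growth j.
Proof. by move=> ltj; have := block_le (leq0n len) (leqnn len) ltj; rewrite /growth; lra. Qed.

Hypothesis moved_small : moved < s / 2.

(** A block that contains a ready point at several calm times is wide, and
    the time it takes to pull it across the point is bounded by its width. *)
Lemma visits_le v j : v \in vs -> (j < nb)%N ->
  u * (count (fun t => b t j <= v%:R * s < b t j.+1) (iota 0 len))%:R <=
  (if reaches (b 0) s (v%:R * s) j then
     growth j + (if eps / 2 < b 0 j.+1 - b 0 j then b 0 j.+1 - b 0 j else 0)
   else 0).
Proof.
move=> vin ltj; set q := v%:R * s; set p := (X in count X _).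
case: (boolP (has p (iota 0 len))) => [|nop]; last first.
  have -> : count p (iota 0 len) = 0%N.
    by apply/eqP; move: nop; rewrite has_count -eqn0Ngt.
  rewrite mulr0; case: ifP => // _; have := growth_ge0 ltj.
  by case: ifP => _; have := row_ge0 ltj; lra.
move=> /hasP[t0]; rewrite mem_iota add0n /= => ltt0 /andP[lo hi].
have wide t : (t <= len)%N -> q < b t j.+1 -> q + eps < b t j.+1.
  move=> lt qb; rewrite ltNge; apply/negP => bq.
  by apply: (calm lt ltj vin); rewrite qb.
have -> : reaches (b 0) s q j.
  apply/andP; split.
    by apply: le_trans lo; apply: boundary_le => //; exact: ltnW.
  have := wide _ (ltnW ltt0) hi; have := moved_ge (ltnW ltt0) ltj.
  by move: u_ge0 u_eps moved_small; lra.
have width : eps < b len j.+1 - b len j.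
  have := block_le (ltnW ltt0) (leqnn len) ltj; have := wide _ (ltnW ltt0) hi; lra.
have : u * (count p (iota 0 len))%:R <=
    u * (count (fun t => q + eps - (b len j.+1 - b len j) <= b t j <= q) (iota 0 len))%:R.
  rewrite ler_wpM2l // ler_nat -!size_filter; apply: uniq_leq_size.
    by rewrite filter_uniq ?iota_uniq.
  move=> t; rewrite !mem_filter mem_iota add0n => /andP[/andP[lot hit] ltt].
  rewrite /= in ltt; rewrite lot ltt !andbT.
  have := block_le (ltnW ltt) (leqnn len) ltj; have := wide _ (ltnW ltt) hit; lra.
move=> /le_trans-> //; apply: le_trans (count_separated_le u_ge0 _ _) _.
- by move=> t ltt; apply: step_ge => //; exact: ltnW.
- by move: u_ge0; lra.
rewrite /growth; case: ltP; move: u_ge0 u_eps; lra.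
Qed.

(** The blocks that reach different ready points are different, so every ready
    point has to be fed separately. *)
Lemma phase_growth : (size vs)%:R * (u * len%:R - eta * s) <= moved.
Proof.
(* At each time the point is in some block, as it stays inside the row. *)
have visit v t : v \in vs -> (t < len)%N ->
    (1 <= count (fun j => (b t j <= v%:R * s < b t j.+1)%R) (iota 0 nb))%N.
  move=> vin ltt; rewrite -has_count; have /and3P[q0 qnb _] := vs_ready vin.
  have [||j ltj ?] := @row_block nb (b t) (v%:R * s).
  - have := moved_ge (ltnW ltt) (leq0n nb); move: moved_small q0; lra.
  - by apply: lt_le_trans qnb _; apply: boundary_le => //; exact: ltnW.
  by apply/hasP; exists j; rewrite // mem_iota.
pose charge v j : R := if reaches (b 0) s (v%:R * s) j then
     growth j + (if eps / 2 < b 0 j.+1 - b 0 j then b 0 j.+1 - b 0 j else 0) else 0.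
have one v : v \in vs -> u * len%:R <= \sum_(0 <= j < nb) charge v j.
  move=> vin; apply: (@le_trans _ _ (\sum_(0 <= j < nb)
      u * (count (fun t => b t j <= v%:R * s < b t j.+1) (iota 0 len))%:R)); last first.
    by rewrite !big_nat; apply: ler_sum => j /andP[_ ltj]; exact: visits_le.
  rewrite -mulr_sumr ler_wpM2l // -natr_sum ler_nat.
  under eq_bigr do rewrite -sum1_count -/(index_iota 0 len) big_mkcond.
  rewrite exchange_big /= -[len in (len <= _)%N]subn0 -[X in (X <= _)%N]muln1 -sum_nat_const_nat.
  rewrite /index_iota subn0 !big_seq; apply: leq_sum => t; rewrite mem_iota => /andP[_ ltt].
  apply: leq_trans (visit _ _ vin ltt) _.
  by rewrite -sum1_count big_mkcond /index_iota subn0.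
(* A block that reached two ready points would be longer than [s / 2]. *)
have owner j : (j < nb)%N -> (count (fun v => reaches (b 0) s (v%:R * s) j) vs <= 1)%N.
  move=> ltj.
  apply: count_le1 => // v w; wlog vw : v w / (v <= w)%N.
    move=> H vin win pv pw; case: (leqP v w) => [|/ltnW] le; first exact: H.
    by apply/esym/H.
  move=> vin win /andP[v1 v2] /andP[w1 w2]; apply/eqP.
  rewrite eqn_leq vw leqNgt; apply/negP => ltvw.
  have /and3P[_ _ cheap] := vs_ready vin.
  have vws : v%:R * s + s <= w%:R * s.
    by rewrite -[X in _ + X]mul1r -mulrDl natr1 ler_pM2r // ler_nat.
  have big : s / 2 < b 0 j.+1 - b 0 j by lra.
  have : b 0 j.+1 - b 0 j <= eta * s.
    apply: le_trans cheap; rewrite big_mkcond (bigD1_seq j) ?mem_index_iota ?iota_uniq //=.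
    rewrite /reaches v1 v2 /=; have -> : eps / 2 < b 0 j.+1 - b 0 j by move: eps_s big; lra.
    rewrite lerDl big_seq_cond; apply: sumr_ge0 => i; rewrite mem_index_iota => /andP[/andP[_ lti] _].
    by case: ifP => // _; have := row_ge0 lti; lra.
  by move: eta2 s_gt0 big; nra.
have cheap v : v \in vs ->
    u * len%:R - eta * s <= \sum_(0 <= j < nb) (reaches (b 0) s (v%:R * s) j)%:R * growth j.
  move=> vin; have /and3P[_ _ le] := vs_ready vin; have := one v vin.
  rewrite (_ : \sum_(0 <= j < nb) charge v j =
    \sum_(0 <= j < nb) (reaches (b 0) s (v%:R * s) j)%:R * growth j +
    \sum_(0 <= j < nb | reaches (b 0) s (v%:R * s) j && (eps / 2 < b 0 j.+1 - b 0 j))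
      (b 0 j.+1 - b 0 j)); first by lra.
  rewrite [X in _ = _ + X]big_mkcond -big_split /=; apply: eq_bigr => j _.
  by rewrite /charge; case: (reaches _ _ _ _) => /=; rewrite ?mul1r ?mul0r ?addr0.
apply: (@le_trans _ _ (\sum_(v <- vs) (u * len%:R - eta * s))).
  by rewrite big_const_seq count_predT iter_addr_0 mulr_natl.
apply: (@le_trans _ _ (\sum_(v <- vs)
    \sum_(0 <= j < nb) (reaches (b 0) s (v%:R * s) j)%:R * growth j)).
  by rewrite !big_seq; apply: ler_sum => v; exact: cheap.
rewrite exchange_big /=; apply: (@le_trans _ _ (\sum_(0 <= j < nb) growth j)).
  rewrite !big_nat; apply: ler_sum => j /andP[_ ltj].
  rewrite -mulr_suml -natr_sum -[X in _ <= X]mul1r ler_wpM2r ?growth_ge0 //.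
  rewrite (ler_nat R _ 1); apply: leq_trans (owner j ltj).
  rewrite -sum1_count [in X in (_ <= X)%N]big_mkcond.
  by apply: leq_sum => v _; case: (reaches _ _ _ _).
rewrite sumrB !increment_sum.
by have := boundary_le (leq0n len) (leqnn len) (leq0n nb); rewrite /moved; lra.
Qed.

End Phase.
Section Ready.
Variables (nb n : nat) (c : nat -> R) (s eps eta H : R).
Hypothesis s_gt0 : 0 < s.
Hypothesis eta_gt0 : 0 < eta.
Hypothesis H_gt0 : 0 < H.
Hypothesis c_mono : forall j, (j < nb)%N -> c j <= c j.+1.
Hypothesis c0_ge0 : 0 <= c 0.
Hypothesis cnb_le : c nb <= n%:R * s.
Hypothesis cnb_le1 : c nb <= 1.

Let d j := c j.+1 - c j.

Lemma reaches_count j : (j < nb)%N ->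
  s * (count (fun v => reaches c s (v%:R * s) j) (iota 0 n))%:R <= d j + 2 * s.
Proof.
move=> ltj; have := c_mono ltj => cj.
apply: (@le_trans _ _ (s * (count (fun v => c j <= v%:R * s <= c j.+1 + s / 2) (iota 0 n))%:R)).
  rewrite ler_wpM2l ?(ltW s_gt0) // ler_nat; apply: sub_count => v /andP[-> vj] /=; lra.
apply: le_trans (count_separated_le (ltW s_gt0) _ _) _.
- by move=> i _; rewrite -[X in _ + X]mul1r -mulrDl natr1.
- by move: s_gt0; lra.
by rewrite /d; move: s_gt0; lra.
Qed.

(** A point fails to be ready because of a huge block, or because the medium
    blocks that reach it add up to [eta * s]. *)
Lemma ready_count :
  (\sum_(0 <= j < nb | d j <= eps / 2) d j) - 2 * s - 2 * s / H -
    (\sum_(0 <= j < nb | eps / 2 < d j <= H) d j) * ((H + 2 * s) / (eta * s)) <=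
  s * (count (fun v => ready nb c s eps eta (v%:R * s)) (iota 0 n))%:R.
Proof.
have d_ge0 j : (j < nb)%N -> 0 <= d j by move=> /c_mono; rewrite /d; lra.
set tiny := \sum_(0 <= j < nb | d j <= eps / 2) d j.
set medium := \sum_(0 <= j < nb | eps / 2 < d j <= H) d j.
pose huge := \sum_(0 <= j < nb | (eps / 2 < d j) && (H < d j)) d j.
have total : tiny + medium + huge = c nb - c 0.
  rewrite -increment_sum (bigID (fun j => d j <= eps / 2)) /= -addrA; congr (_ + _).
  rewrite [RHS](bigID (fun j => d j <= H)) /=; congr (_ + _).
    by apply: eq_bigl => j; rewrite -ltNge.
  by apply: eq_bigl => j; rewrite -!ltNge.
pose range v := c 0 + s / 2 <= v%:R * s < c nb.
pose bad v := range v && (eta * s <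
  \sum_(0 <= j < nb | reaches c s (v%:R * s) j && (eps / 2 < d j)) d j).
have split_range : (count range (iota 0 n) <=
    count (fun v => ready nb c s eps eta (v%:R * s)) (iota 0 n) + count bad (iota 0 n))%N.
  rewrite -count_predUI; apply: leq_trans (leq_addr _ _).
  apply: sub_count => v rv /=; rewrite /bad rv /= /ready.
  have /andP[-> ->] := rv; rewrite /=.
  by case: leP.
have range_ge := count_multiples_ge (ltW s_gt0) (_ : 0 <= c 0 + s / 2) cnb_le.
have {}range_ge := range_ge (addr_ge0 c0_ge0 (divr_ge0 (ltW s_gt0) (ler0n R 2))).
(* One huge block suffices to make a point bad; a medium block contributes its
   share of the admissible total [eta * s]. *)
pose w j := if H < d j then 1 else d j / (eta * s).
have es_gt0 : 0 < eta * s by rewrite mulr_gt0.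
have w_ge0 j : (j < nb)%N -> 0 <= w j.
  by move=> ltj; rewrite /w; case: ifP => // _; rewrite divr_ge0 ?d_ge0 ?ltW.
have bad_le v : (bad v)%:R <= \sum_(0 <= j < nb)
    (reaches c s (v%:R * s) j && (eps / 2 < d j))%:R * w j.
  case: (boolP (bad v)) => [/andP[rv]|_]; last first.
    rewrite big_nat; apply: sumr_ge0 => j /andP[_ ltj].
    by rewrite mulr_ge0 ?ler0n ?w_ge0.
  case: (boolP (has (fun j => reaches c s (v%:R * s) j && (eps / 2 < d j) && (H < d j)) (iota 0 nb))).
    move=> /hasP[j]; rewrite mem_iota add0n /= => ltj /andP[rj hj] _.
    rewrite (bigD1_seq j) ?mem_index_iota ?iota_uniq //= rj /w hj mulr1 lerDl.
    rewrite big_seq_cond; apply: sumr_ge0 => k; rewrite mem_index_iota => /andP[/andP[_ ltk] _].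
    by rewrite mulr_ge0 ?ler0n ?w_ge0.
  move=> /hasPn small sum_gt; apply: ltW.
  rewrite (_ : \sum_(0 <= j < nb) _ = (\sum_(0 <= j < nb | reaches c s (v%:R * s) j && (eps / 2 < d j)) d j) / (eta * s)).
    by rewrite ltr_pdivlMr // mul1r.
  rewrite mulr_suml [RHS]big_mkcond !big_nat; apply: eq_bigr => j /andP[_ ltj].
  have := small j; rewrite mem_iota add0n /w => /(_ ltj); rewrite negb_and.
  by case: (reaches _ _ _ _ && _) => /=; rewrite ?mul0r // mul1r => /negbTE ->.
have bad_count : s * (count bad (iota 0 n))%:R <= huge + 2 * s / H +
    medium * ((H + 2 * s) / (eta * s)).
  apply: (@le_trans _ _ (\sum_(0 <= j < nb | eps / 2 < d j) w j * (d j + 2 * s))).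
    apply: (@le_trans _ _ (s * \sum_(v <- iota 0 n) \sum_(0 <= j < nb)
        (reaches c s (v%:R * s) j && (eps / 2 < d j))%:R * w j)).
      rewrite ler_wpM2l ?(ltW s_gt0) // -sum1_count natr_sum big_mkcond.
      by apply: ler_sum => v _; have := bad_le v; case: (bad v).
    rewrite exchange_big /= mulr_sumr [X in _ <= X]big_mkcond !big_nat.
    apply: ler_sum => j /andP[_ ltj]; rewrite -mulr_suml.
    case: ifP => _; last first.
      by rewrite big1 ?mul0r ?mulr0 // => v _; rewrite andbF.
    rewrite [_ * w j]mulrC mulrCA ler_wpM2l ?w_ge0 //.
    apply: le_trans (reaches_count ltj); rewrite ler_wpM2l ?(ltW s_gt0) //.
    rewrite -sum1_count natr_sum [X in _ <= X]big_mkcond.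
    by apply: ler_sum => v _; rewrite andbT; case: (reaches _ _ _ _).
  rewrite (bigID (fun j => H < d j)) /=.
  have huge_le1 : huge <= 1.
    have t0 : 0 <= tiny by rewrite /tiny big_nat_cond; apply: sumr_ge0 => j /andP[/andP[_ /d_ge0]].
    have m0 : 0 <= medium by rewrite /medium big_nat_cond; apply: sumr_ge0 => j /andP[/andP[_ /d_ge0]].
    by move: total cnb_le1 c0_ge0; lra.
  apply: lerD.
    apply: (@le_trans _ _ (huge * (1 + 2 * s / H))).
      rewrite /huge mulr_suml big_nat_cond [X in _ <= X]big_nat_cond.
      apply: ler_sum => j /andP[_ /andP[_ Hd]]; rewrite /w Hd mul1r mulrDr mulr1 lerD2l.
      have h : 1 <= d j / H by rewrite ler_pdivlMr // mul1r ltW.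
      have -> : d j * (2 * s / H) = (2 * s) * (d j / H) by rewrite mulrCA.
      by move: h s_gt0; nra.
    rewrite mulrDr mulr1 lerD2l -[X in _ <= X]mul1r ler_wpM2r //.
    by rewrite divr_ge0 ?mulr_ge0 ?ltW.
  rewrite /medium mulr_suml big_nat_cond [X in _ <= X]big_nat_cond.
  rewrite (eq_bigl (fun j => ((0 <= j < nb)%N && (eps / 2 < d j <= H)))); last first.
    by move=> j; rewrite -leNgt.
  apply: ler_sum => j /andP[/andP[_ ltj] /andP[_ dH]]; rewrite /w ltNge dH /=.
  rewrite -mulrA ler_wpM2l ?d_ge0 // mulrC ler_wpM2r ?invr_ge0 ?(ltW es_gt0) //.
  by rewrite lerD2r.
have : s * (count range (iota 0 n))%:R <=
    s * (count (fun v => ready nb c s eps eta (v%:R * s)) (iota 0 n))%:R + s * (count bad (iota 0 n))%:R.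
  by rewrite -mulrDr -natrD ler_wpM2l ?(ltW s_gt0) // ler_nat.
have m0 : 0 <= medium.
  by rewrite /medium big_nat_cond; apply: sumr_ge0 => j /andP[/andP[_ /d_ge0]].
move: m0 range_ge; rewrite -/range; move: bad_count total s_gt0.
set A := s * (count range _)%:R; set B := s * (count bad _)%:R.
set C := s * (count _ _)%:R; set D := medium * _; set E := 2 * s / H; lra.
Qed.

End Ready.
End Row.

Section Game.
Variable R : realFieldType.

Definition pow2 n : R := 2^-1 ^+ n.

Lemma pow2_gt0 n : 0 < pow2 n.
Proof. by rewrite exprn_gt0 // invr_gt0. Qed.

Lemma pow2D m n : pow2 (m + n) = pow2 m * pow2 n.
Proof. exact: exprD. Qed.

Lemma pow2S n : pow2 n = 2 * pow2 n.+1.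
Proof. by rewrite /pow2 exprS mulrA divff ?mul1r // pnatr_eq0. Qed.

Lemma pow2_le m n : (n <= m)%N -> pow2 m <= pow2 n.
Proof.
move=> /subnK <-; rewrite addnC pow2D -[X in _ <= X]mulr1.
by rewrite ler_wpM2l ?(ltW (pow2_gt0 _)) //; apply: exprn_ile1; lra.
Qed.

Lemma pow2V n : pow2 n * 2 ^+ n = 1.
Proof. by rewrite /pow2 -exprMn mulVf ?expr1n // pnatr_eq0. Qed.

Lemma pow2_mulX m n : pow2 (m + n) * 2 ^+ n = pow2 m.
Proof. by rewrite pow2D -mulrA pow2V mulr1. Qed.

Lemma scale_expS b : scale_exp b.+1 = (scale_exp b + 8 * b + 20)%N.
Proof. rewrite /scale_exp; lia. Qed.

Lemma scale_exp_mono b b' : (b <= b')%N -> (scale_exp b <= scale_exp b')%N.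
Proof. by move=> le; rewrite leq_sqr; lia. Qed.

Lemma row_exp_ge a b : (b < a + scales_nb a)%N ->
  (scale_exp b + 8 * b + 20 <= row_exp a)%N.
Proof. by move=> lt; rewrite -scale_expS scale_exp_mono. Qed.

Lemma scale_exp_ge b : (5 * b + 7 <= scale_exp b)%N.
Proof. rewrite /scale_exp; nia. Qed.

Section Row.
Variables (a nb : nat) (c : nat -> R).
Let u := pow2 (2 * a + 1 + row_exp a).
Let mesh b := pow2 (scale_exp b).
Let gap b := pow2 (scale_exp b + gap_exp b + 1).
Let huge b := mesh b * 2 ^+ (3 * a + 6).
Let d j := c j.+1 - c j.
Hypothesis fine : forall j, (j < nb)%N -> u <= d j.
Hypothesis long : pow2 (3 * a + 1) <= nb.+1%:R * u.
Hypothesis c0_ge0 : 0 <= c 0.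
Hypothesis cnb_le1 : c nb <= 1.

(** The row has so many blocks, each of length at least [u], that those that are
    not tiny can be neglected: there are at most [2 / gap b] of them. *)
Lemma tiny_ge b : (a <= b < a + scales_nb a)%N ->
  pow2 (3 * a + 2) <= \sum_(0 <= j < nb | d j <= gap b / 2) d j.
Proof.
move=> /andP[leab ltb]; set tiny := \sum_(_ <= _ < _ | _) _.
have u_gt0 : 0 < u := pow2_gt0 _.
pose rest := \sum_(0 <= j < nb | ~~ (d j <= gap b / 2)) d j.
have g_gt0 : 0 < gap b / 2 by rewrite divr_gt0 ?pow2_gt0.
have total : tiny + rest = c nb - c 0.
  by rewrite -increment_sum [RHS](bigID (fun j => d j <= gap b / 2)).
have tiny_ge0 : 0 <= tiny.
  rewrite /tiny big_nat_cond; apply: sumr_ge0 => j /andP[/andP[_ ltj] _].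
  exact: le_trans (ltW u_gt0) (fine ltj).
have : nb%:R * u <= tiny + rest * (u / (gap b / 2)).
  rewrite -[nb]subn0 mulr_natl -sumr_const_nat (bigID (fun j => d j <= gap b / 2)) /=.
  apply: lerD.
    rewrite /tiny big_nat_cond [X in _ <= X]big_nat_cond.
    by apply: ler_sum => j /andP[/andP[_ ltj] _]; exact: fine.
  rewrite /rest mulr_suml; apply: ler_sum => j; rewrite -ltNge => wide.
  by rewrite mulrCA -[X in X <= _]mulr1 ler_pM2l // ler_pdivlMr // mul1r ltW.
have : rest * (u / (gap b / 2)) <= u / (gap b / 2).
  rewrite -[X in _ <= X]mul1r ler_pM2r ?divr_gt0 //; move: c0_ge0 cnb_le1; lra.
have : u / (gap b / 2) <= pow2 (3 * a + 3).
  rewrite ler_pdivrMr // (_ : gap b / 2 = pow2 (scale_exp b + gap_exp b + 2)); last first.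
    by have := pow2S (scale_exp b + gap_exp b + 1); rewrite -addnS /gap; lra.
  rewrite -pow2D; apply: pow2_le; have := row_exp_ge ltb; rewrite /gap_exp; lia.
have : u <= pow2 (3 * a + 3).
  by apply: pow2_le; have := row_exp_ge ltb; have := scale_exp_ge b; lia.
have := pow2S (3 * a + 1); have := pow2S (3 * a + 2).
rewrite -!addnS /= => e1 e2; move: long; rewrite -natr1 mulrDl mul1r e2 e1.
lra.
Qed.

Let medium b := \sum_(0 <= j < nb | gap b / 2 < d j <= huge b) d j.

Lemma d_ge0 j : (j < nb)%N -> 0 <= d j.
Proof. by move=> /fine; apply: le_trans; exact: ltW (pow2_gt0 _). Qed.

Lemma huge_le_gap b b' : (a <= b)%N -> (b < b')%N -> huge b' <= gap b / 2.
Proof.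
move=> leab ltb; rewrite (_ : gap b / 2 = pow2 (scale_exp b + gap_exp b + 2)); last first.
  by have := pow2S (scale_exp b + gap_exp b + 1); rewrite -addnS /gap; lra.
have := scale_exp_mono ltb; rewrite scale_expS => le.
rewrite /huge /mesh; set e := (3 * a + 6)%N.
rewrite -(pow2_mulX (scale_exp b + gap_exp b + 2) e) ler_wpM2r ?exprn_ge0 //.
by apply: pow2_le; rewrite /e /gap_exp; lia.
Qed.

(** The ranges of medium sizes of distinct scales are disjoint, so one of the
    many scales sees few medium blocks. *)
Lemma few_medium : exists2 b, (a <= b < a + scales_nb a)%N & medium b <= pow2 (8 * a + 17).
Proof.
case: (boolP (has (fun b => medium b <= pow2 (8 * a + 17))
  (index_iota a (a + scales_nb a)))) => [/hasP[b]|/hasPn none].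
  by rewrite mem_index_iota => rb le; exists b.
have big b : (a <= b < a + scales_nb a)%N -> pow2 (8 * a + 17) < medium b.
  by move=> rb; rewrite ltNge; apply: none; rewrite mem_index_iota.
have : \sum_(a <= b < a + scales_nb a) medium b <= 1.
  apply: (@le_trans _ _ (\sum_(0 <= j < nb) d j)); last first.
    by rewrite increment_sum; move: c0_ge0 cnb_le1; lra.
  rewrite /medium; under eq_bigr do rewrite big_mkcond.
  rewrite exchange_big /= !big_nat; apply: ler_sum => j /andP[_ ltj].
  rewrite -big_mkcond big_const_seq iter_addr_0 -[X in _ <= X]mulr1n.
  rewrite ler_wpMn2l ?d_ge0 //; apply: count_le1; first exact: iota_uniq.
  move=> x y; wlog : x y / (x <= y)%N.
    move=> H xin yin px py; case: (leqP x y) => [|/ltnW] le; first exact: H.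
    by apply/esym/H.
  rewrite leq_eqVlt => /orP[/eqP //|ltxy].
  rewrite mem_index_iota => /andP[lax _] _ /andP[gx _] /andP[_ hy].
  by have := lt_le_trans gx (le_trans hy (huge_le_gap lax ltxy)); rewrite ltxx.
have : 1 < \sum_(a <= b < a + scales_nb a) medium b.
  have -> : 1 = \sum_(a <= b < a + scales_nb a) pow2 (8 * a + 17).
    by rewrite sumr_const_nat addKn -mulr_natr natrX pow2V.
  rewrite big_nat_cond [X in _ < X]big_nat_cond; apply: ltr_sum.
    by apply/hasP; exists a; rewrite ?mem_index_iota leqnn /= -[X in (X < _)%N]addn0 ltn_add2l expn_gt0.
  by move=> b /andP[rb _]; exact: big.
lra.
Qed.

(** At the scale with few medium blocks, the grid points that are not ready make
    up a small part of what the tiny blocks cover. *)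
Lemma good_scale : exists2 b, (a <= b < a + scales_nb a)%N &
  2 ^+ (2 * a + 4) <= (count (fun v => ready nb c (mesh b) (gap b) (pow2 (2 * a + 5))
                            (v%:R * mesh b)) (iota 0 (2 ^ scale_exp b)))%:R :> R.
Proof.
have [b rb few] := few_medium; exists b => //; set cnt := (count _ _)%:R : R.
have mesh_gt0 : 0 < mesh b := pow2_gt0 _.
have huge_gt0 : 0 < huge b by apply: mulr_gt0 => //; exact: exprn_gt0.
have top : c nb <= (2 ^ scale_exp b)%:R * mesh b by rewrite natrX mulrC pow2V.
have mono j : (j < nb)%N -> c j <= c j.+1 by move=> /d_ge0; rewrite /d; lra.
have := @ready_count R nb (2 ^ scale_exp b)%N c (mesh b) (gap b)
  (pow2 (2 * a + 5)) (huge b) mesh_gt0 (pow2_gt0 _) huge_gt0 mono c0_ge0 top cnb_le1.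
rewrite -/cnt.
have /andP[leab ltb] := rb; have tiny := tiny_ge rb.
have cost : medium b * ((huge b + 2 * mesh b) / (pow2 (2 * a + 5) * mesh b)) <= pow2 (3 * a + 5).
  have -> : (huge b + 2 * mesh b) / (pow2 (2 * a + 5) * mesh b) = (2 ^+ (3 * a + 6) + 2) * 2 ^+ (2 * a + 5).
    apply: (mulIf (x := pow2 (2 * a + 5) * mesh b)); first by rewrite mulf_neq0 ?gt_eqF ?pow2_gt0.
    rewrite divfK ?mulf_neq0 ?gt_eqF ?pow2_gt0 //.
    have := pow2V (2 * a + 5); rewrite /huge.
    move: (2 ^+ (2 * a + 5)) (pow2 (2 * a + 5)) (2 ^+ (3 * a + 6)) (mesh b) => Y P X m PY.
    have -> : (X + 2) * Y * (P * m) = (X + 2) * m * (P * Y) by ring.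
    by rewrite PY; ring.
  apply: (@le_trans _ _ (pow2 (8 * a + 17) * (2 ^+ (3 * a + 7) * 2 ^+ (2 * a + 5)))).
    apply: ler_pM few _.
    - by rewrite /medium big_nat_cond; apply: sumr_ge0 => j /andP[/andP[_ /d_ge0]].
    - by apply: mulr_ge0; [apply: addr_ge0; [exact: exprn_ge0|]|exact: exprn_ge0].
    rewrite ler_wpM2r ?exprn_ge0 //.
    have : 1 <= 2 ^+ (3 * a + 5) :> R by rewrite exprn_ege1 // ler1n.
    have -> : 2 ^+ (3 * a + 6) = 2 * 2 ^+ (3 * a + 5) :> R by rewrite -exprS -addnS.
    have -> : 2 ^+ (3 * a + 7) = 2 * (2 * 2 ^+ (3 * a + 5)) :> R by rewrite -!exprS -!addnS.
    lra.
  rewrite -exprD (_ : (8 * a + 17 = 3 * a + 5 + (3 * a + 7 + (2 * a + 5)))%N); last by lia.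
  by rewrite pow2_mulX.
have ratio : 2 * mesh b / huge b = pow2 (3 * a + 5).
  rewrite /huge; set X := 2 ^+ _; have X_gt0 : 0 < X :> R by rewrite exprn_gt0.
  apply: (mulIf (x := mesh b * X)); first by rewrite mulf_neq0 ?gt_eqF.
  rewrite divfK ?mulf_neq0 ?gt_eqF //.
  have -> : X = 2 * 2 ^+ (3 * a + 5) by rewrite -exprS -addnS.
  have := pow2V (3 * a + 5); move: (2 ^+ _) (pow2 _) (mesh b) => Y P m PY.
  have -> : P * (m * (2 * Y)) = 2 * m * (P * Y) by ring.
  by rewrite PY mulr1.
have mesh_le : mesh b <= pow2 (3 * a + 5).
  by apply: pow2_le; have := scale_exp_ge b; lia.
have mesh_le2 : 2 ^+ (2 * a + 4) * mesh b <= pow2 (3 * a + 3).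
  rewrite -(pow2_mulX (3 * a + 3) (2 * a + 4)) mulrC ler_wpM2r ?exprn_ge0 //.
  by apply: pow2_le; have := scale_exp_ge b; lia.
have e1 := pow2S (3 * a + 2); have e2 := pow2S (3 * a + 3); have e3 := pow2S (3 * a + 4).
rewrite -!addnS /= in e1 e2 e3.
move=> H; rewrite -(ler_pM2r mesh_gt0) [cnt * _]mulrC; move: H.
rewrite -/(medium b) ratio; set X := medium b * _ in cost *; set Y := mesh b * cnt.
move: tiny cost mesh_le mesh_le2; set Z := _ * mesh b; lra.
Qed.

End Row.
Section Play.
Variables (a nb : nat) (b : nat -> nat -> R).
Let T := (2 ^ row_exp a)%N.
Let u := pow2 (2 * a + 1 + row_exp a).
Let gap e := pow2 (scale_exp e + gap_exp e + 1).
Hypothesis b_ge0 : forall t, (t <= T)%N -> 0 <= b t 0.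
Hypothesis b_le1 : forall t, (t <= T)%N -> b t nb <= 1.
Hypothesis grow : forall t j, (t < T)%N -> (j < nb)%N ->
  b t j.+1 - b t j <= b t.+1 j.+1 - b t.+1 j.
Hypothesis push : forall t, (t < T)%N -> b t 0 + u <= b t.+1 0.
Hypothesis fine : forall j, (j < nb)%N -> u <= b 0 j.+1 - b 0 j.
Hypothesis long : pow2 (3 * a + 1) <= nb.+1%:R * u.
Hypothesis calm : forall t j e v, (t <= T)%N -> (j <= nb)%N ->
  (a <= e < a + scales_nb a)%N ->
  ~ (v%:R * pow2 (scale_exp e) < b t j <= v%:R * pow2 (scale_exp e) + gap e).

Lemma fine_later t j : (t <= T)%N -> (j < nb)%N -> u <= b t j.+1 - b t j.
Proof.
move=> + ltj; elim: t => [|t IH] lt; first exact: fine.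
by apply: le_trans (IH (ltnW lt)) _; exact: grow.
Qed.

(** Each of the [2 ^ (2 * a + 4)] ready points of a good scale absorbs at least
    half of the push. *)
Lemma phase t : (t <= T)%N -> exists len, [/\ (0 < len)%N, (2 * len <= T)%N &
  (t + len <= T)%N -> 2 ^+ (2 * a + 3) * (u * len%:R) <= b (t + len)%N nb - b t nb].
Proof.
move=> lt; have [e re many] := good_scale (fun j => @fine_later t j lt) long (b_ge0 lt) (b_le1 lt).
have /andP[lea lte] := re; have rowe := row_exp_ge lte.
set k := scale_exp e in many rowe; set s := pow2 k in many.
(* The length makes the total push [s / 2] divided by [2 ^ (2 * a + 3)]. *)
pose len := (2 ^ (row_exp a - k - 3))%N.
have ulen : u * len%:R = pow2 (2 * a + 4 + k).
  rewrite /u /len natrX -(pow2_mulX (2 * a + 4 + k) (row_exp a - k - 3)).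
  by congr (pow2 _ * _); lia.
have s_gt0 : 0 < s := pow2_gt0 _.
have pay : 2 ^+ (2 * a + 3) * (u * len%:R) = s / 2.
  have -> : s / 2 = pow2 (k + 1) by have := pow2S k; rewrite addn1 /s; lra.
  by rewrite ulen mulrC -(pow2_mulX (k + 1) (2 * a + 3)); congr (pow2 _ * _); lia.
exists len; split; first by rewrite expn_gt0.
  by rewrite -expnS leq_exp2l //; lia.
move=> ltlen; rewrite pay leNgt; apply/negP => small.
pose vs := [seq v <- iota 0 (2 ^ k) |
  ready nb (b t) s (gap e) (pow2 (2 * a + 5)) (v%:R * s)].
have := @phase_growth R nb len (fun i => b (t + i)%N) u (gap e) s (pow2 (2 * a + 5)) vs.
have u_ge0 : 0 <= u := ltW (pow2_gt0 _).
have u_gap : u <= gap e / 2.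
  have -> : gap e / 2 = pow2 (k + gap_exp e + 2).
    by have := pow2S (k + gap_exp e + 1); rewrite -addnS /gap; lra.
  by apply: pow2_le; rewrite /gap_exp; lia.
have gap_s : gap e <= s by apply: pow2_le; rewrite -addnA leq_addr.
have eta_small : pow2 (2 * a + 5) < 2^-1.
  have h1 := pow2S 1; have h0 := pow2S 0; have h2 : pow2 0 = 1 := expr0 _.
  by have := @pow2_le (2 * a + 5) 2 ltac:(lia); lra.
move=> /(_ u_ge0 u_gap s_gt0 gap_s eta_small).
have lti i : (i < len)%N -> (t + i < T)%N by move=> ?; lia.
have grow' i j : (i < len)%N -> (j < nb)%N ->
    b (t + i)%N j.+1 - b (t + i)%N j <= b (t + i.+1)%N j.+1 - b (t + i.+1)%N j.
  by move=> /lti h ltj; rewrite addnS; exact: grow.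
have row0 j : (j < nb)%N -> b (t + 0)%N j <= b (t + 0)%N j.+1.
  by move=> ltj; rewrite addn0; have := fine_later lt ltj; lra.
have push' i : (i < len)%N -> b (t + i)%N 0 + u <= b (t + i.+1)%N 0.
  by move=> /lti h; rewrite addnS; exact: push.
have calm' i j v : (i <= len)%N -> (j <= nb)%N -> v \in vs ->
    ~ (v%:R * s < b (t + i)%N j <= v%:R * s + gap e).
  by move=> lei lej _; apply: calm => //; lia.
move=> /(_ grow' row0 push' calm' (filter_uniq _ (iota_uniq _ _))).
have vsP v : v \in vs -> ready nb (b (t + 0)%N) s (gap e) (pow2 (2 * a + 5)) (v%:R * s).
  by rewrite addn0 mem_filter => /andP[].
move=> /(_ vsP); rewrite addn0 => /(_ small) most.
(* The blocks that are not tiny save at most half of the push. *)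
have half : u * len%:R - pow2 (2 * a + 5) * s = pow2 (2 * a + 5 + k).
  have := pow2S (2 * a + 4 + k); rewrite ulen /s -pow2D.
  by rewrite (_ : (2 * a + 4 + k).+1 = (2 * a + 5 + k)%N); [lra|lia].
have : s / 2 <= (size vs)%:R * (u * len%:R - pow2 (2 * a + 5) * s).
  have -> : s / 2 = 2 ^+ (2 * a + 4) * pow2 (2 * a + 5 + k).
    have -> : s / 2 = pow2 (k + 1) by have := pow2S k; rewrite addn1 /s; lra.
    by rewrite mulrC -(pow2_mulX (k + 1) (2 * a + 4)); congr (pow2 _ * _); lia.
  by rewrite half size_filter ler_wpM2r // ltW ?pow2_gt0.
by move: small; lra.
Qed.

(** In total the row would have to grow by more than [1]. *)
Lemma game : False.
Proof.
have u_gt0 : 0 < u := pow2_gt0 _.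
have C_gt0 : 0 < 2 ^+ (2 * a + 3) :> R by rewrite exprn_gt0.
(* Phases follow each other until at least half of the time is over. *)
have run n t : (T - t <= n)%N -> (t <= T)%N ->
    2 ^+ (2 * a + 3) * (u * t%:R) <= b t nb - b 0 nb ->
    exists2 t', (t' <= T)%N && (T <= 2 * t')%N &
      2 ^+ (2 * a + 3) * (u * t'%:R) <= b t' nb - b 0 nb.
  elim: n t => [|n IH] t len lt paid; first by exists t => //; lia.
  have [l [l0 l2 step]] := phase lt.
  case: (leqP (t + l) T) => [ltl|ltT]; last by exists t => //; lia.
  apply: (IH (t + l)%N) => //; first by lia.
  by have := step ltl; rewrite natrD !mulrDr; lra.
have start : 2 ^+ (2 * a + 3) * (u * 0%:R) <= b 0 nb - b 0 nb.
  by rewrite !mulr0 subrr.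
have [t /andP[ltT leT] paid] := run T 0%N (leq_subr _ _) (leq0n _) start.
have row0 : b 0 0 <= b 0 nb.
  have : forall j, (j <= nb)%N -> b 0 0 <= b 0 j.
    elim=> [//|j IH] ltj; have := IH (ltnW ltj); have := fine ltj; lra.
  exact.
have : 2 <= 2 ^+ (2 * a + 3) * (u * t%:R).
  apply: (@le_trans _ _ (2 ^+ (2 * a + 3) * (pow2 (2 * a + 2)))).
    have -> : 2 ^+ (2 * a + 3) = 2 * 2 ^+ (2 * a + 2) :> R by rewrite -exprS -addnS.
    by rewrite -mulrA [2 ^+ _ * _]mulrC pow2V mulr1.
  rewrite ler_wpM2l ?(ltW C_gt0) //.
  have -> : pow2 (2 * a + 2) = u * T%:R / 2.
    rewrite /u /T natrX pow2_mulX; have := pow2S (2 * a + 1); rewrite -addnS; lra.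
  rewrite -mulrA ler_wpM2l ?(ltW u_gt0) // ler_pdivrMr // -natrM ler_nat mulnC.
  by [].
by have := b_le1 ltT; have := b_ge0 (leq0n T); lra.
Qed.

End Play.
End Game.

(** * Sums over predicates *)

Section SumOver.
Variable R : realType.
Variable f : nat -> R.
Hypothesis f_ge0 : forall y, 0 <= f y.
Hypothesis sum_le1 : forall n, \sum_(0 <= y < n) f y <= 1.

Definition sum_over (P : pred nat) : R := fine (\esum_(y in [set y | P y]) (f y)%:E).

Let fE_ge0 y : (0 <= (f y)%:E)%E. Proof. by rewrite lee_fin. Qed.

Lemma partial_le (P : pred nat) n : \sum_(0 <= y < n | P y) f y <= 1.
Proof.
apply: le_trans (sum_le1 n); rewrite [X in X <= _]big_mkcond.
by apply: ler_sum => y _; case: ifP.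
Qed.

Lemma sum_overE (P : pred nat) : \esum_(y in [set y | P y]) (f y)%:E = (sum_over P)%:E.
Proof.
rewrite /sum_over fineK // -nneseries_esum //.
apply/fin_numP; split.
  by apply/eqP => h; have := @nneseries_ge0 R _ P 0 (fun n _ _ => fE_ge0 n); rewrite h.
apply/eqP => h; suff : (+oo <= 1%:E :> \bar R)%E by [].
rewrite -h; apply: lime_le; first exact: is_cvg_nneseries.
by apply: nearW => n; rewrite sumEFin lee_fin partial_le.
Qed.

Lemma partial_le_sum_over (P : pred nat) n : \sum_(0 <= y < n | P y) f y <= sum_over P.
Proof.
rewrite -lee_fin -sum_overE -nneseries_esum // -sumEFin.
exact: nneseries_lim_ge.
Qed.

Lemma sum_over_split (P : pred nat) : sum_over P + sum_over (predC P) = sum_over predT.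
Proof.
apply/EFin_inj; rewrite EFinD -!sum_overE.
rewrite [RHS](esumID [set y | P y]) //; congr (_ + _)%E; congr esum.
  by apply/seteqP; split=> y //= -[].
by apply/seteqP; split=> y /=; [move=> /negP|move=> [_ /negP]].
Qed.

(** The sum is the supremum of its partial sums. *)
Lemma sum_over_approx delta : 0 < delta ->
  exists n, sum_over predT <= \sum_(0 <= y < n) f y + delta.
Proof.
move=> d0.
have ndS : nondecreasing_seq (fun n => \sum_(0 <= y < n) (f y)%:E)%E.
  exact: ereal_nondecreasing_series.
have supE : ereal_sup (range (fun n => \sum_(0 <= y < n) (f y)%:E)%E) = (sum_over predT)%:E.
  rewrite -sum_overE -nneseries_esum //.
  by apply/esym/cvg_lim => //; exact: ereal_nondecreasing_cvgn.
have [|_ [n _ <-]] := @ub_ereal_sup_adherent R (range (fun n => \sum_(0 <= y < n) (f y)%:E)%E) _ d0.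
  by rewrite supE.
rewrite supE sumEFin -EFinB lte_fin => lt; exists n; lra.
Qed.

End SumOver.

(** * Kraft's inequality *)

Section Kraft.
Variable R : realType.

Lemma kraft_nil (S : seq bitseq) : uniq S ->
  (forall s t, s \in S -> t \in S -> prefix s t -> s = t) ->
  [::] \in S -> S = [:: [::]].
Proof.
case: S => [|a [|b S]] // uS free nilS; first by move: nilS; rewrite inE => /eqP <-.
have Ea := free _ _ nilS (mem_head a _) (prefix0s _).
have Eb := free _ _ nilS (mem_behead (s := [:: a, b & S]) (mem_head b S)) (prefix0s _).
by move: uS; rewrite -Ea -Eb.
Qed.

(** Induction on the length: the strings that start with a given bit form, once
    it is removed, a prefix-free set of half the weight. *)
Lemma kraft (S : seq bitseq) : uniq S ->
  (forall s t, s \in S -> t \in S -> prefix s t -> s = t) ->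
  \sum_(s <- S) pow2 R (size s) <= 1.
Proof.
have : forall s, s \in S -> (size s <= \max_(s <- S) size s)%N.
  by move=> s sS; exact: leq_bigmax_seq.
move: (\max_(s <- S) size s)%N => n; elim: n S => [|n IH] S len uS free;
  (case: (boolP ([::] \in S)) => [nilS|nnil]; [|try by
    case: S nnil len {uS free} => [|s S]; [rewrite big_nil|
      move=> + /(_ s (mem_head _ _)); rewrite leqn0 => + /nilP s0; rewrite s0 mem_head]]).
- have -> : S = [:: [::]] by exact: kraft_nil.
  by rewrite big_seq1 /pow2 expr0.
- have -> : S = [:: [::]] by exact: kraft_nil.
  by rewrite big_seq1 /pow2 expr0.
pose part b := [seq behead s | s <- S & head (~~ b) s == b].
have memS b t : t \in part b -> b :: t \in S.
  move=> /mapP[s]; rewrite mem_filter => /andP[hs sS] ->.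
  by case: s hs sS => [|c s] /=; [rewrite eqb_negLR; case: b|move=> /eqP ->].
have Sum : \sum_(s <- S) pow2 R (size s) =
    \sum_(s <- part true) pow2 R (size s).+1 + \sum_(s <- part false) pow2 R (size s).+1.
  rewrite !big_map !big_filter (bigID (fun s => head false s == true)) /=.
  congr (_ + _); rewrite big_seq_cond [RHS]big_seq_cond.
    by apply: eq_big => [[|b s] //|[|b s] //]; rewrite (negbTE nnil).
  apply: eq_big => [[|b s] //|[|b s] //]; rewrite ?(negbTE nnil) //=.
    by case: b.
have bound b : \sum_(s <- part b) pow2 R (size s) <= 1.
  apply: IH.
  - by move=> t /memS /len.
  - rewrite map_inj_in_uniq ?filter_uniq // => s t.
    rewrite !mem_filter => /andP[hs _] /andP[ht _].
    by case: s t hs ht => [|c s] [|c' t] //=; rewrite ?eqb_negLR; case: b => //=; case: c => //; case: c' => // _ _ ->.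
  - move=> s t /memS sS /memS tS st.
    have cst : prefix (b :: s) (b :: t) by rewrite /= eqxx.
    by case: (free _ _ sS tS cst).
rewrite Sum; have h b : \sum_(s <- part b) pow2 R (size s).+1 <= 2^-1.
  have -> : \sum_(s <- part b) pow2 R (size s).+1 = 2^-1 * \sum_(s <- part b) pow2 R (size s).
    by rewrite mulr_sumr; apply: eq_bigr => s _; rewrite /pow2 exprS.
  by rewrite -[X in _ <= X]mulr1 ler_wpM2l ?invr_ge0.
by have := h true; have := h false; lra.
Qed.

End Kraft.

(** * Weights of strings *)

Section Complexity.
Variable R : realType.
Implicit Types (U M : pfun_str) (u t : bitseq).

Lemma K_le U t u : U t = Some u -> (K R U u <= (size t)%:R%:E)%E.
Proof. by move=> Ut; apply: ereal_inf_lbound; exists t. Qed.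

Lemma K_leP U u n : (K R U u <= n%:R%:E)%E ->
  exists2 t, U t = Some u & (size t <= n)%N.
Proof.
move=> Kn; apply: contrapT => none.
have : (n.+1%:R%:E <= K R U u)%E.
  apply: le_ereal_inf_tmp => _ [t /= Ut <-]; rewrite lee_fin ler_nat ltnNge.
  by apply/negP => le; apply: none; exists t.
by move=> /le_trans/(_ Kn); rewrite lee_fin ler_nat ltnn.
Qed.

Lemma pow2N_shortest U t u : U t = Some u ->
  (forall t', U t' = Some u -> (size t <= size t')%N) ->
  pow2N (K R U u) = (pow2 R (size t))%:E.
Proof.
move=> Ut mint; have -> : K R U u = (size t)%:R%:E.
  apply/eqP; rewrite eq_le K_le //=; apply: le_ereal_inf_tmp => _ [t' /= Ut' <-].
  by rewrite lee_fin ler_nat mint.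
by rewrite /pow2N powRN powR_mulrn // /pow2 exprVn.
Qed.

Lemma pow2N_none U u : (forall t, U t <> Some u) -> pow2N (K R U u) = 0%E.
Proof.
move=> none; rewrite /K (_ : [set t | U t = Some u] = set0) ?image_set0 ?ereal_inf0 //.
by apply/seteqP; split=> t //= /none.
Qed.

Section Machine.
Variables (U : pfun_str) (e : recfun 1).
Hypothesis eU : forall s y, recfun_eval e [tuple strcode s] y <->
  exists2 t, U s = Some t & y = strcode t.
Hypothesis freeU : prefix_free [set s | U s <> None].

Lemma run_machine t u :
  U t = Some u <-> exists s, run e s [:: strcode t] = (strcode u).+1.
Proof.
have := runP e [tuple strcode t] (strcode u); rewrite eU => <-.
by split=> [->|[u' -> /strcode_inj ->]] //; exists u.
Qed.

Lemma program_found s y : (program e s y < s)%N ->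
  U (strdec (program e s y)) = Some (strdec y).
Proof.
move=> /find_iota_lt[/eqP found _]; apply/run_machine; exists s.
by rewrite !strdecK.
Qed.

Lemma program_le s c y : (c < s)%N -> run e s [:: c] = y.+1 -> (program e s y <= c)%N.
Proof.
move=> ltc runc; rewrite leqNgt; apply/negP => lt.
by have := before_find 0 lt; rewrite nth_iota ?add0n ?runc ?eqxx.
Qed.

Lemma program_mono s s' y : (s <= s')%N -> (program e s y < s)%N ->
  (program e s' y <= program e s y)%N.
Proof.
move=> les lts; apply: program_le; first exact: leq_trans les.
by have [/eqP found _] := find_iota_lt lts; exact: run_mono found.
Qed.

(** The weight of the string with code [y], and its approximation at stage
    [s]. *)
Definition wt y : R := fine (pow2N (K R U (strdec y))).
Definition stage_weight s y : R := (weight e s y)%:R * pow2 R s.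

Lemma stage_weightE s y : (program e s y < s)%N ->
  stage_weight s y = pow2 R (size (strdec (program e s y))).
Proof.
move=> lts; have := strlenE (strdec (program e s y)); rewrite strdecK => lenE.
have lens : (size (strdec (program e s y)) <= s)%N.
  have /andP[lo _] := strcode_size (strdec (program e s y)); rewrite strdecK in lo.
  by have := ltn_expl (size (strdec (program e s y))) (ltnSn 1); lia.
rewrite /stage_weight /weight lts lenE mulrC natrX.
by rewrite -{1}(subnKC lens) pow2_mulX.
Qed.

Lemma stage_weight0 s y : ~~ (program e s y < s)%N -> stage_weight s y = 0.
Proof. by rewrite /stage_weight /weight => /negbTE ->; rewrite mul0r. Qed.

Lemma stage_weight_ge0 s y : 0 <= stage_weight s y.
Proof. by rewrite mulr_ge0 // ltW // pow2_gt0. Qed.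

Lemma strdec_size_le c c' : (c <= c')%N -> (size (strdec c) <= size (strdec c'))%N.
Proof. by move=> le; apply: leq_strcode_size; rewrite !strdecK. Qed.

Lemma stage_weight_mono s s' y : (s <= s')%N -> stage_weight s y <= stage_weight s' y.
Proof.
move=> les; case: (boolP (program e s y < s)%N) => [lts|/stage_weight0->]; last exact: stage_weight_ge0.
have lep := program_mono les lts.
rewrite !stage_weightE //; last by apply: leq_ltn_trans lep _; exact: leq_trans les.
exact/pow2_le/strdec_size_le.
Qed.

Lemma wt_limit y : exists s0, forall s, (s0 <= s)%N -> stage_weight s y = wt y.
Proof.
case: (pselect (exists t, U t = Some (strdec y))) => [ex|none]; last first.
  exists 0%N => s _; rewrite /wt pow2N_none => [|t Ut]; last by apply: none; exists t.
  by rewrite stage_weight0 //; apply/negP => /program_found Up; apply: none; eexists; exact: Up.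
have ex' : exists c, `[< U (strdec c) = Some (strdec y) >].
  by case: ex => t Ut; exists (strcode t); apply/asboolP; rewrite strcodeK.
case: (ex_minnP ex') => c /asboolP Uc minc.
have [s1 run1] := (run_machine _ _).1 Uc; rewrite !strdecK in run1.
exists (maxn s1 c.+1) => s; rewrite geq_max => /andP[le1 ltc].
have runs := run_mono le1 run1.
have lep := program_le ltc runs.
have lts : (program e s y < s)%N by exact: leq_ltn_trans ltc.
have progE : program e s y = c.
  by apply/eqP; rewrite eqn_leq lep minc //; apply/asboolP; exact: program_found.
rewrite stage_weightE // progE /wt (pow2N_shortest Uc) // => t Ut.
rewrite -(strcodeK t); apply: strdec_size_le; apply: minc.
by apply/asboolP; rewrite strcodeK.
Qed.

Lemma stage_weight_le_wt s y : stage_weight s y <= wt y.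
Proof.
have [s0 wtE] := wt_limit y; rewrite -(wtE (maxn s s0)) ?leq_maxr //.
by apply: stage_weight_mono; rewrite leq_maxl.
Qed.

Lemma wt_ge0 y : 0 <= wt y.
Proof. exact: le_trans (stage_weight_ge0 0 y) (stage_weight_le_wt 0 y). Qed.

Lemma wt_limit_seq n : exists s0, forall s, (s0 <= s)%N ->
  forall y, (y < n)%N -> stage_weight s y = wt y.
Proof.
elim: n => [|n [s0 IH]]; first by exists 0%N.
have [s1 wtE] := wt_limit n; exists (maxn s0 s1) => s.
rewrite geq_max => /andP[le0 le1] y; rewrite ltnS leq_eqVlt => /orP[/eqP ->|lty].
  exact: wtE.
exact: IH.
Qed.

(** The programs that are found for different outputs are different. *)
Lemma sum_stage_weight_le1 s n : \sum_(0 <= y < n) stage_weight s y <= 1.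
Proof.
pose found := [seq y <- iota 0 n | (program e s y < s)%N].
have -> : \sum_(0 <= y < n) stage_weight s y =
    \sum_(t <- [seq strdec (program e s y) | y <- found]) pow2 R (size t).
  rewrite big_map big_filter /index_iota subn0 [RHS]big_mkcond.
  by apply: eq_bigr => y _; case: ifPn => [/stage_weightE|/stage_weight0].
have foundP t : t \in [seq strdec (program e s y) | y <- found] ->
    exists2 y, t = strdec (program e s y) & U t = Some (strdec y).
  by move=> /mapP[y]; rewrite mem_filter => /andP[/program_found Uy _] ->; exists y.
apply: kraft.
  rewrite map_inj_in_uniq ?filter_uniq ?iota_uniq // => y y'.
  rewrite !mem_filter => /andP[/program_found Uy _] /andP[/program_found Uy' _] E.
  by apply: (can_inj strdecK); move: Uy; rewrite E Uy' => -[].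
move=> t t' /foundP[y _ Ut] /foundP[y' _ Ut']; apply: freeU => /=.
  by rewrite Ut.
by rewrite Ut'.
Qed.

Lemma sum_wt_le1 n : \sum_(0 <= y < n) wt y <= 1.
Proof.
have [s0 wtE] := wt_limit_seq n; rewrite (le_trans _ (sum_stage_weight_le1 s0 n)) //.
by rewrite !big_nat; apply: ler_sum => y /andP[_ lty]; rewrite wtE.
Qed.

Definition stage_mass s (P : pred nat) : R := \sum_(0 <= y < s | P y) stage_weight s y.

Lemma mass_mono s s' P : (s <= s')%N -> stage_mass s P <= stage_mass s' P.
Proof.
move=> les; rewrite /stage_mass [X in _ <= X](big_cat_nat _ (n := s)) //=.
rewrite -[X in X <= _]addr0; apply: lerD; last by apply: sumr_ge0 => y _; exact: stage_weight_ge0.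
by apply: ler_sum => y _; exact: stage_weight_mono.
Qed.

Lemma mass_le_sum_over s P : stage_mass s P <= sum_over wt P.
Proof.
apply: le_trans (partial_le_sum_over wt_ge0 sum_wt_le1 P s).
by apply: ler_sum => y _; exact: stage_weight_le_wt.
Qed.

Lemma mass_le1 s P : stage_mass s P <= 1.
Proof.
apply: le_trans (sum_stage_weight_le1 s s); rewrite /stage_mass [X in X <= _]big_mkcond.
by apply: ler_sum => y _; case: ifP => // _; exact: stage_weight_ge0.
Qed.

(** The convergence is uniform in the predicate, because what is missing from
    the mass of a predicate is missing from the total mass. *)
Lemma mass_limit delta : 0 < delta -> exists s0, forall s, (s0 <= s)%N ->
  forall P, sum_over wt P <= stage_mass s P + delta.
Proof.
move=> d0; have [n approx] := sum_over_approx wt_ge0 sum_wt_le1 d0.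
have [s0 wtE] := wt_limit_seq n; exists (maxn s0 n) => s.
rewrite geq_max => /andP[les len] P.
have split := sum_over_split wt_ge0 sum_wt_le1 P.
have rest := partial_le_sum_over wt_ge0 sum_wt_le1 (predC P) n.
have partE : \sum_(0 <= y < n) wt y =
    \sum_(0 <= y < n | P y) wt y + \sum_(0 <= y < n | ~~ P y) wt y by exact: bigID.
have : \sum_(0 <= y < n | P y) wt y <= stage_mass s P.
  rewrite /stage_mass [X in _ <= X](big_cat_nat _ (n := n)) //= -[X in X <= _]addr0.
  apply: lerD; last by apply: sumr_ge0 => y _; exact: stage_weight_ge0.
  rewrite big_nat_cond [X in _ <= X]big_nat_cond.
  by apply: ler_sum => y /andP[/andP[_ lty] _]; rewrite wtE.
by move: rest; rewrite /predC /=; lra.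
Qed.

Definition at_most (x : nat -> bool) : pred nat := fun y => `[< leL (strdec y) x >].

Lemma Omega_sum_over x : Omega_fun R U x = sum_over wt (at_most x).
Proof.
rewrite /Omega_fun /sum_over; congr fine.
have bij : set_bij [set y | at_most x y] [set s | leL s x] strdec.
  split.
  - by move=> y /= /asboolP.
  - by move=> y y' _ _; exact: (can_inj strdecK).
  - move=> s /= lesx; exists (strcode s); last exact: strcodeK.
    by apply/asboolP; rewrite strcodeK.
rewrite (reindex_esum _ _ _ _ bij); apply: eq_esum => y _.
rewrite /wt fineK //; case: (pselect (exists t, U t = Some (strdec y))) => [ex|none].
  have ex' : exists n, `[< exists2 t, U t = Some (strdec y) & size t = n >].
    by case: ex => t Ut; exists (size t); apply/asboolP; exists t.
  case: (ex_minnP ex') => n /asboolP[t Ut <-] mint.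
  rewrite (pow2N_shortest Ut) // => t' Ut'; apply: mint.
  by apply/asboolP; exists t'.
by rewrite pow2N_none // => t Ut; apply: none; exists t.
Qed.

End Machine.
End Complexity.

(** * The order of strings and binary expansions *)

Lemma mkseqS (T : Type) (x : nat -> T) n : mkseq x n.+1 = x 0%N :: mkseq (fun i => x i.+1) n.
Proof. by rewrite /mkseq /= -[1%N]addn0 iotaDl -map_comp. Qed.

Lemma leL_cons b s x : leL (b :: s) x <->
  (~~ b && x 0%N) \/ (b = x 0%N /\ leL s (fun i => x i.+1)).
Proof.
split.
  case=> [[[|n] [/= ltn tk s0 x1]]|].
  - by left; rewrite s0 x1.
  - move: tk; rewrite mkseqS => -[-> tk]; right; split=> //; left; exists n.
    by split.
  - by rewrite /= mkseqS => -[-> E]; right; split=> //; right.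
case=> [/andP[nb x0]|[-> [[n [ltn tk s0 x1]]|E]]].
- by left; exists 0%N; rewrite take0 /=; split=> //; apply: negbTE.
- by left; exists n.+1; rewrite /= mkseqS tk.
- by right; rewrite /= mkseqS -E.
Qed.

Lemma leL_val s x n : (size s <= n)%N ->
  leL s x <-> (strval s * 2 ^ (n - size s) <= strval (mkseq x n))%N.
Proof.
elim: s x n => [|b s IH] x n.
  by move=> _; rewrite mul0n leq0n; split=> // _; right.
case: n => // n; rewrite ltnS => les; rewrite leL_cons (IH _ _ les) mkseqS /= subSS.
rewrite size_mkseq mulnDl -mulnA -expnD subnKC //.
have ltx := strval_lt (mkseq (fun i => x i.+1) n); rewrite size_mkseq in ltx.
have lts : (strval s * 2 ^ (n - size s) < 2 ^ n)%N.
  by rewrite -{2}(subnKC les) expnD ltn_pmul2r ?expn_gt0 // strval_lt.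
set A := (strval s * 2 ^ (n - size s))%N in lts *.
set B := strval (mkseq _ n) in ltx *; move: A B lts ltx => A B ltA ltB.
case: b => /=; case: (x 0%N) => /=; rewrite ?mul1n ?mul0n ?add0n; split.
- by case=> // -[_]; rewrite leq_add2l.
- by rewrite leq_add2l; right.
- by case=> // -[].
- by lia.
- by move=> _; lia.
- by left.
- by case=> // -[].
- by right.
Qed.

Lemma mkseq_nth_pad u n : (size u <= n)%N ->
  mkseq (nth false u) n = u ++ nseq (n - size u) false.
Proof.
move=> leun; apply: (@eq_from_nth _ false) => [|i]; rewrite size_mkseq.
  by rewrite size_cat size_nseq subnKC.
move=> lti; rewrite nth_mkseq // nth_cat nth_nseq.
case: ltnP => // leui; rewrite nth_default //.
by case: ifP.
Qed.

(** The order [leL] compares a string with a dyadic point by their values; so it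
    is decidable there, and a cone is an interval. *)
Lemma leL_dyadic s u :
  leL s (nth false u) <-> (strval s * 2 ^ size u <= strval u * 2 ^ size s)%N.
Proof.
rewrite (leL_val _ (leq_addr (size u) (size s))) addKn mkseq_nth_pad ?leq_addl //.
by rewrite addnK strval_cat strval_nseq0 addn0 size_nseq.
Qed.

Lemma leL_local s x x' n : (size s <= n)%N -> mkseq x n = mkseq x' n ->
  leL s x <-> leL s x'.
Proof. by move=> les E; rewrite !(leL_val _ les) E. Qed.

Section Expansion.
Variable R : realType.

Lemma strval_mkseqS z n :
  strval (mkseq z n.+1) = (2 * strval (mkseq z n) + z n)%N.
Proof.
rewrite -addn1 /mkseq iotaD map_cat /= strval_cat /= add0n; lia.
Qed.

Lemma partial_expansion (z : nat -> bool) n :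
  [series (z i)%:R / 2 ^+ i.+1 : R]_i n = (strval (mkseq z n))%:R * pow2 R n.
Proof.
rewrite /series /=; elim: n => [|n IH]; first by rewrite big_geq // mul0r.
rewrite strval_mkseqS big_nat_recr //= IH natrD natrM mulrDl (pow2S R n).
by rewrite mulrCA mulrA; congr (_ + _ * _); rewrite /pow2 exprVn.
Qed.

Lemma expansion_bounds (y : R) z n : binary_expansion y z ->
  (strval (mkseq z n))%:R * pow2 R n <= y <= (strval (mkseq z n)).+1%:R * pow2 R n.
Proof.
rewrite /binary_expansion; set S := [series _]_i => Sy.
have SE := partial_expansion z; rewrite -/S in SE.
have mono i j : (i <= j)%N -> S i <= S j.
  move=> leij; rewrite -(subnKC leij); elim: (j - i)%N => [|k IH]; first by rewrite addn0.
  rewrite addnS (le_trans IH) // !SE strval_mkseqS natrD natrM (pow2S R (i + k)).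
  by have p0 := pow2_gt0 R (i + k).+1; case: (z _) => /=; nra.
have upper i : (n <= i)%N -> S i + pow2 R i <= S n + pow2 R n.
  move=> lei; rewrite -(subnKC lei); elim: (i - n)%N => [|k IH]; first by rewrite addn0.
  apply: le_trans IH; rewrite addnS !SE strval_mkseqS natrD natrM (pow2S R (n + k)).
  have p0 := pow2_gt0 R (n + k).+1; case: (z _) => /=; nra.
have Scvg : cvgn S by apply/cvg_ex; exists y.
have <- : limn S = y by exact/cvg_lim.
apply/andP; split.
  rewrite -SE; apply: limr_ge => //; near=> i; apply: mono; near: i.
  exact: nbhs_infty_ge.
rewrite -natr1 mulrDl mul1r -SE; apply: limr_le => //; near=> i.
apply: le_trans (upper i _); last by near: i; exact: nbhs_infty_ge.
by rewrite lerDl ltW // pow2_gt0.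
Unshelve. all: by end_near.
Qed.

End Expansion.

(** * Cones without random values *)

Lemma eventually_all (P : nat -> nat -> Prop) n :
  (forall j, (j < n)%N -> exists s0, forall s, (s0 <= s)%N -> P j s) ->
  exists s0, forall s, (s0 <= s)%N -> forall j, (j < n)%N -> P j s.
Proof.
elim: n => [|n IH] ev; first by exists 0%N.
have [s0 H0] := IH (fun j ltj => ev j (ltnW ltj)); have [s1 H1] := ev n (ltnSn n).
exists (maxn s0 s1) => s; rewrite geq_max => /andP[le0 le1] j.
by rewrite ltnS leq_eqVlt => /orP[/eqP -> |ltj]; [exact: H1|exact: H0].
Qed.

Lemma gap_mod A v D C : (1 < C)%N -> (v * D < A)%N -> (A * C <= v * D * C + D)%N ->
  ~~ ((A %% D == 0)%N || (D < A %% D * C)%N).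
Proof.
move=> C1 lo hi; have AE : A = (v * D + (A - v * D))%N by rewrite subnKC // ltnW.
move: (A - v * D)%N AE => x AE; move: lo hi; rewrite {}AE => lo hi.
have xC : (x * C <= D)%N by nia.
by rewrite modnMDl modn_small ?negb_or -?leqNgt ?xC ?andbT; nia.
Qed.

Section Cone.
Variable R : realType.
Variables (U : pfun_str) (e : recfun 1).
Hypothesis eU : forall s y, recfun_eval e [tuple strcode s] y <->
  exists2 t, U s = Some t & y = strcode t.
Hypothesis freeU : prefix_free [set s | U s <> None].
Hypothesis optU : forall M, prefix_free_machine M ->
  exists c : nat, forall s, (K R U s <= K R M s + c%:R%:E)%E.

Definition random_with c (y : R) := exists2 z, binary_expansion y z &
  forall n : nat, ((n%:R - c%:R)%:E <= K R U (mkseq z n))%E.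

Lemma optimal_bound M : prefix_free_machine M -> exists c : nat,
  forall t u, M t = Some u -> (K R U u <= (size t + c)%:R%:E)%E.
Proof.
move=> /optU[c Hc]; exists c => t u Mt; apply: le_trans (Hc u) _.
by rewrite natrD EFinD leeD2r //; exact: K_le.
Qed.

Local Notation apx := (stage_weight R e).
Local Notation mass := (stage_mass R e).
Local Notation Omega := (Omega_fun R U).

Lemma stage_weight_ge u n : (K R U u <= n%:R%:E)%E ->
  exists s0, forall s, (s0 <= s)%N -> pow2 R n <= apx s (strcode u).
Proof.
move=> /K_leP[t Ut szt]; have [s1 run1] := (run_machine eU t u).1 Ut.
exists (maxn s1 (strcode t).+1) => s; rewrite geq_max => /andP[le1 ltt].
have lep := program_le ltt (run_mono le1 run1).
rewrite stage_weightE; last exact: leq_ltn_trans ltt.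
by apply: pow2_le; apply: leq_trans szt; rewrite -(strcodeK t); exact: strdec_size_le.
Qed.

Lemma mass_sub s (P Q : pred nat) : (forall y, P y -> Q y) ->
  mass s Q = mass s P + mass s (fun y => Q y && ~~ P y).
Proof.
move=> PQ; rewrite /stage_mass (bigID P) /=; congr (_ + _).
by apply: eq_bigl => y; case Py : (P y); rewrite ?andbF ?(PQ _ Py).
Qed.

Lemma mass_ge s (P : pred nat) y : (y < s)%N -> P y -> apx s y <= mass s P.
Proof.
move=> lty Py; rewrite /stage_mass big_mkcond (bigD1_seq y) ?mem_index_iota ?iota_uniq //= Py.
rewrite lerDl; apply: sumr_ge0 => i _; case: ifP => // _; exact: stage_weight_ge0.
Qed.

Lemma Omega_ge s x : mass s (at_most x) <= Omega x.
Proof. by rewrite Omega_sum_over; exact: mass_le_sum_over. Qed.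

Lemma Omega_limit delta : 0 < delta -> exists s0, forall s, (s0 <= s)%N ->
  forall x, Omega x <= mass s (at_most x) + delta.
Proof.
move=> /(mass_limit eU freeU)[s0 H]; exists s0 => s les x.
by rewrite Omega_sum_over; exact: H.
Qed.

Lemma Omega_le1 x : Omega x <= 1.
Proof.
apply/ler_addgt0Pr => d d0; have [s0 H] := Omega_limit d0.
by apply: le_trans (H s0 (leqnn _) x) _; rewrite lerD2r; exact: mass_le1.
Qed.

(** Reals that share a long initial segment have close values, because the
    strings that carry almost all the weight do not separate them. *)
Lemma Omega_continuous delta : 0 < delta -> exists n, forall x x',
  mkseq x n = mkseq x' n -> Omega x <= Omega x' + delta.
Proof.
move=> d0; have [n H] := Omega_limit d0; exists n => x x' E.
apply: le_trans (H n (leqnn n) x) _; rewrite lerD2r; apply: le_trans (Omega_ge n x').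
rewrite le_eqVlt; apply/orP; left; apply/eqP.
rewrite /stage_mass big_nat_cond [RHS]big_nat_cond; apply: eq_bigl => y.
case: (ltnP y n) => lty; rewrite ?andbF //; congr (_ && _).
have lesz : (size (strdec y) <= n)%N.
  have /andP[lo _] := strcode_size (strdec y); rewrite strdecK in lo.
  by have := ltn_expl (size (strdec y)) (ltnSn 1); lia.
by rewrite /at_most; apply: asbool_equiv_eq; exact: leL_local lesz E.
Qed.

(** All expansions of reals in this open interval start with that string. *)
Lemma random_gap c k m v y : (v < 2 ^ k)%N ->
  (K R U (bits k v ++ nseq m false) + c.+1%:R%:E <= (k + m)%:R%:E)%E ->
  random_with c y ->
  ~ (v%:R * pow2 R k < y < v%:R * pow2 R k + pow2 R (k + m)).
Proof.
move=> ltv cheap [z yz rnd] /andP[vy yv].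
have /andP[zy yz'] := expansion_bounds (k + m) yz.
have p0 := pow2_gt0 R (k + m).
have vE : v%:R * pow2 R k = (v * 2 ^ m)%:R * pow2 R (k + m).
  by rewrite natrM natrX -(pow2_mulX R k m); ring.
have szE : strval (mkseq z (k + m)) = (v * 2 ^ m)%N.
  apply/eqP; rewrite eqn_leq -ltnS -[X in _ && X]ltnS; apply/andP; split.
    rewrite -(ltr_nat R) -(ltr_pM2r p0) -[X in _ < X * _]natr1 mulrDl mul1r -vE.
    exact: le_lt_trans zy yv.
  rewrite -(ltr_nat R) -(ltr_pM2r p0) -vE.
  exact: lt_le_trans vy yz'.
have E : mkseq z (k + m) = bits k v ++ nseq m false.
  apply: strval_inj; first by rewrite size_mkseq size_cat size_bits size_nseq.
  by rewrite szE strval_cat strval_nseq0 addn0 size_nseq strval_bits.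
have := rnd (k + m)%N; rewrite E => rn.
have := le_trans (leeD2r c.+1%:R%:E rn) cheap.
by rewrite -EFinD lee_fin -natr1; lra.
Qed.

Section Row.
Variables (sigma : bitseq) (a c : nat).
Hypothesis sigma_a : (size sigma <= a)%N.
Let r := row_exp a.
Let g := size sigma.

Lemma sigma_row : (size sigma <= r)%N.
Proof.
apply: leq_trans sigma_a _; rewrite /r /row_exp /scale_exp /scales_nb.
by have := ltn_expl (8 * a + 17) (ltnSn 1); nia.
Qed.

Definition row_point j := sigma ++ bits (r - size sigma) j.

Lemma size_row_point j : size (row_point j) = r.
Proof. by rewrite size_cat size_bits subnKC // sigma_row. Qed.

Lemma strval_row_point j : (j < row_len sigma a)%N ->
  strval (row_point j) = (row_start sigma a + j)%N.
Proof. by move=> ltj; rewrite strval_cat size_bits strval_bits. Qed.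

Lemma at_most_row_point j y : (j < row_len sigma a)%N ->
  at_most (nth false (row_point j)) y =
  (codeval y * 2 ^ r <= (row_start sigma a + j) * 2 ^ strlen y)%N.
Proof.
move=> ltj; rewrite -{2 3}(strdecK y) codevalE strlenE -strval_row_point //.
rewrite -[X in (2 ^ X)%N](size_row_point j).
by apply/asboolP/idP => /leL_dyadic.
Qed.

Definition bnd s j : R := mass s (at_most (nth false (row_point j))).

Lemma bndE s j : (j < row_len sigma a)%N ->
  bnd s j = (boundary e sigma s a j)%:R * pow2 R s.
Proof.
move=> ltj; rewrite /bnd /stage_mass /boundary /below natr_sum mulr_suml big_mkcond.
apply: eq_bigr => y _; rewrite at_most_row_point // /stage_weight.
by case: ifP => _; rewrite ?mul1n // mul0n mul0r.
Qed.

Lemma row_len_gt0 : (0 < row_len sigma a)%N.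
Proof. by rewrite expn_gt0. Qed.

Lemma at_most_succ j y : (j.+1 < row_len sigma a)%N ->
  at_most (nth false (row_point j)) y -> at_most (nth false (row_point j.+1)) y.
Proof.
move=> ltj; rewrite !at_most_row_point ?(ltnW ltj) // => /leq_trans; apply.
by rewrite leq_mul2r addnS leqnSn orbT.
Qed.

Lemma bnd_grow s s' j : (s <= s')%N -> (j.+1 < row_len sigma a)%N ->
  bnd s j.+1 - bnd s j <= bnd s' j.+1 - bnd s' j.
Proof.
move=> les ltj; have sub y := @at_most_succ j y ltj.
rewrite /bnd !(mass_sub _ sub) ![_ + mass _ _ - _]addrAC !subrr !add0r.
exact: mass_mono.
Qed.

(** What the three machines provide. *)
Hypothesis cheap_grid : forall b w, (a <= b)%N -> size w = scale_exp b ->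
  (K R U (w ++ nseq (gap_exp b) false) + c.+1%:R%:E <= (scale_exp b + gap_exp b)%:R%:E)%E.
Hypothesis cheap_row : forall w, size w = r -> (K R U w <= (2 * a + 1 + r)%:R%:E)%E.
Hypothesis cheap_zeros : forall s, request e sigma a s ->
  (requests e sigma a s < 2 ^ r)%N ->
  (K R U (nseq s false) <= (2 * a + 1 + r)%:R%:E)%E.

(** A counterexample to the claim: random values are dense around the row. *)
Hypothesis dense : forall tau, prefix sigma tau -> exists x,
  tau = mkseq x (size tau) /\ random_with c (Omega x).

(** A random value close to the boundary would lie in the interval as well. *)
Lemma row_gap j b v : (a <= b)%N -> (v < 2 ^ scale_exp b)%N ->
  let y := Omega (nth false (row_point j)) in
  let q := v%:R * pow2 R (scale_exp b) in
  ~ (q < y < q + pow2 R (scale_exp b + gap_exp b)).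
Proof.
move=> leab ltv /= /andP[qy yq].
set y := Omega _ in qy yq; set q := v%:R * _ in qy yq; set gap := pow2 R _ in yq.
pose delta := Num.min (y - q) (q + gap - y) / 2.
have [d1 d2 d0] : [/\ delta < y - q, delta < q + gap - y & 0 < delta].
  rewrite /delta; case: (leP (y - q) (q + gap - y)) => h; split; lra.
have [n near] := Omega_continuous d0.
pose tau := row_point j ++ nseq n false.
have [|x [tauE rnd]] := dense (tau := tau).
  by rewrite /tau /row_point -catA prefix_prefix.
have big : mkseq x (size tau) = mkseq (nth false (row_point j)) (size tau).
  by rewrite -tauE mkseq_nth_pad /tau size_cat ?leq_addr // addKn size_nseq.
have E : mkseq x n = mkseq (nth false (row_point j)) n.
  have takeE (z : nat -> bool) : mkseq z n = take n (mkseq z (size tau)).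
    rewrite /mkseq -map_take take_iota; congr map; congr iota; apply/esym/minn_idPl.
    by rewrite /tau size_cat size_nseq leq_addl.
  by rewrite !takeE big.
have h1 := near _ _ E; have h2 := near _ _ (esym E).
apply: (random_gap ltv (cheap_grid leab (size_bits _ _)) rnd).
rewrite -/q -/gap; apply/andP; split; move: h1 h2; rewrite -/y; lra.
Qed.

(** The approximations increase to a limit that is not in the open interval,
    whereas [clear_row] only forbids its left half; this leaves room for the
    limit to be the right end. *)
Lemma clear_eventually : exists s0, forall s, (s0 <= s)%N -> clear_row e sigma a s.
Proof.
have [s0 H] : exists s0, forall s, (s0 <= s)%N -> forall j, (j < row_len sigma a)%N ->
    forall b, (b < scales_nb a)%N ->
    let x := (boundary e sigma s a j * 2 ^ scale_exp (a + b) %% 2 ^ s)%N in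
    (x == 0%N) || (2 ^ s < x * 2 ^ (gap_exp (a + b) + 1))%N.
  apply: eventually_all => j ltj; apply: eventually_all => b _.
  set k := scale_exp _; set m := gap_exp _.
  set y := Omega (nth false (row_point j)).
  have y1 : y <= 1 := Omega_le1 _.
  have exn : exists n, y <= n%:R * pow2 R k.
    by exists (2 ^ k)%N; rewrite natrX mulrC pow2V.
  case: (ex_minnP exn) => -[|v] yv minv.
    exists 0%N => s _; apply/orP; left.
    have b0 : bnd s j <= 0.
      by apply: le_trans (Omega_ge s _) _; move: yv; rewrite mul0r.
    move: b0; rewrite bndE // pmulr_lle0 ?pow2_gt0 // lern0 => /eqP ->.
    by rewrite mul0n mod0n.
  have vy : v%:R * pow2 R k < y.
    by rewrite ltNge; apply/negP => /minv; rewrite ltnn.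
  have ltv : (v < 2 ^ k)%N.
    rewrite -(ltr_nat R) -(ltr_pM2r (pow2_gt0 R k)); apply: lt_le_trans vy _.
    by rewrite natrX [leRHS]mulrC pow2V.
  have far : v%:R * pow2 R k + pow2 R (k + m) <= y.
    rewrite leNgt; apply/negP => yq.
    by apply: (@row_gap j (a + b) v (leq_addr _ _) ltv); rewrite /= -/y vy yq.
  (* An error of a quarter of the interval keeps the approximation beyond
     its middle. *)
  have [s0 near] := Omega_limit (pow2_gt0 R (k + m + 2)).
  exists s0 => s les; have := near s les (nth false (row_point j)).
  rewrite -/y -/(bnd s j) => yb; set X := boundary _ _ _ _ _.
  have Yb : bnd s j <= v.+1%:R * pow2 R k by apply: le_trans (Omega_ge s _) yv.
  have bE := bndE s ltj; rewrite -/X in bE.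
  have p2 : pow2 R (k + m) = 2 * pow2 R (k + m + 1) by rewrite addn1 -pow2S.
  have p3 : pow2 R (k + m + 1) = 2 * pow2 R (k + m + 2).
    by rewrite addn2 addn1 -pow2S.
  set q := (X * 2 ^ k %/ 2 ^ s)%N; set x := (_ %% _)%N.
  have XE : (X * 2 ^ k = q * 2 ^ s + x)%N by exact: divn_eq.
  have bq : bnd s j = q%:R * pow2 R k + x%:R * (pow2 R s * pow2 R k).
    have : (X * 2 ^ k)%:R * pow2 R k * pow2 R s = X%:R * pow2 R s :> R.
      by rewrite natrM natrX -[X%:R * _ * _]mulrA [2 ^+ k * _]mulrC pow2V mulr1.
    rewrite -bE XE => <-; rewrite natrD natrM natrX.
    by have := pow2V R s; move: (2 ^+ s) (pow2 R s) => A B BA; rewrite !mulrDl -!mulrA [A * _]mulrCA [A * B]mulrC BA; ring.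
  apply: contraT; rewrite negb_or -leqNgt -lt0n => /andP[x0 xs].
  have ps := pow2_gt0 R s; have pk := pow2_gt0 R k.
  have ltqv : (q <= v)%N.
    rewrite -ltnS -(ltr_nat R) -(ltr_pM2r pk); apply: lt_le_trans Yb.
    by rewrite bq ltrDl !mulr_gt0 // ltr0n.
  have small : x%:R * (pow2 R s * pow2 R k) <= pow2 R (k + m + 1).
    have : (x * 2 ^ (m + 1))%:R * pow2 R s <= 1.
      by rewrite -[leRHS](pow2V R s) [leRHS]mulrC ler_pM2r // -natrX ler_nat.
    rewrite natrM natrX -addnA pow2D => h.
    have := ler_wpM2r (mulr_ge0 (ltW pk) (ltW (pow2_gt0 R (m + 1)))) h.
    rewrite mul1r; apply: le_trans; rewrite le_eqVlt; apply/orP; left; apply/eqP.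
    by have := pow2V R (m + 1); move: (2 ^+ _) (pow2 R (m + 1)) => A B BA; rewrite -[LHS]mulr1 -BA; ring.
  have : q%:R * pow2 R k <= v%:R * pow2 R k by rewrite ler_pM2r // ler_nat.
  move=> qv; suff : (1 : R) < 0 by rewrite ltr10.
  have := pow2_gt0 R (k + m + 2); move: far yb small qv; rewrite bq p2 p3; lra.
exists s0 => s les; apply/allP => j; rewrite mem_iota add0n /= => ltj.
by apply/allP => b; rewrite mem_iota add0n /= => ltb; exact: H.
Qed.

Lemma fine_eventually : exists s0, forall s, (s0 <= s)%N -> fine_row e sigma a s.
Proof.
have [s0 H] : exists s0, forall s, (s0 <= s)%N -> forall j, (j < (row_len sigma a).-1)%N ->
    bnd s j + pow2 R (2 * a + 1 + r) <= bnd s j.+1.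
  apply: eventually_all => j ltj; have ltj1 : (j.+1 < row_len sigma a)%N by lia.
  have [s1 near] := stage_weight_ge (cheap_row (size_row_point j.+1)).
  exists (maxn s1 (strcode (row_point j.+1)).+1) => s; rewrite geq_max => /andP[le1 lts].
  have sub y := @at_most_succ j y ltj1.
  rewrite /bnd (mass_sub _ sub) lerD2l; apply: le_trans (near s le1) _.
  apply: mass_ge => //; rewrite !at_most_row_point ?(ltnW ltj1) //.
  rewrite codevalE strlenE size_row_point strval_row_point // leqnn /=.
  by rewrite -ltnNge ltn_pmul2r ?expn_gt0 // ltn_add2l.
exists s0 => s les; apply/allP => j; rewrite mem_iota add0n /= => ltj.
have := H s les j ltj; rewrite !bndE ?(leq_trans ltj) ?leq_pred //; last by lia.
have ps := pow2_gt0 R s; have pr := pow2V R (2 * a + 1 + r).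
move: (boundary _ _ _ _ j) (boundary _ _ _ _ j.+1) => X Y h.
rewrite -(ler_nat R) natrD !natrM !natrX -(ler_pM2r ps).
move: h pr (pow2V R s) => h pr psV.
have := ler_wpM2r (exprn_ge0 (2 * a + 1 + r) (ler0n R 2)) h; rewrite mulrDl pr.
rewrite mulrDl [2 ^+ s * _]mulrC psV mulrAC [X in _ <= X]mulrAC; exact.
Qed.

Lemma calm_eventually : exists s0, forall s, (s0 <= s)%N -> calm_row e sigma a s.
Proof.
have [s0 H0] := clear_eventually; have [s1 H1] := fine_eventually.
exists (maxn s0 s1) => s; rewrite geq_max => /andP[le0 le1].
by apply/andP; split; [exact: H1|exact: H0].
Qed.

Lemma served_eventually k : request e sigma a k -> (requests e sigma a k < 2 ^ r)%N ->
  exists s0, forall s, (s0 <= s)%N -> served e a s k.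
Proof.
move=> rk ltk; have [s0 H] := stage_weight_ge (cheap_zeros rk ltk).
exists (maxn s0 (2 ^ k)) => s; rewrite geq_max => /andP[le0 le2].
rewrite /served le2 /=; have := H s le0; rewrite -(strcode_nseq0 k) /= /stage_weight => h.
rewrite -(ler_nat R) natrM !natrX -(ler_pM2r (pow2_gt0 R s)) [leLHS]mulrC pow2V.
have := ler_wpM2r (exprn_ge0 (2 * a + 1 + r) (ler0n R 2)) h.
by rewrite pow2V mulrAC.
Qed.

(** The string of [s] zeros does not count yet at stage [s], because of the size
    of its code. *)
Lemma served_mass s s' : served e a s' s -> (s < s')%N ->
  bnd s 0 + pow2 R (2 * a + 1 + r) <= bnd s' 0.
Proof.
move=> /andP[lts]; rewrite -(strcode_nseq0 s) /=; set y := strcode _ => wy ltss.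
have lty : (y < s')%N by rewrite /y -ltnS (strcode_nseq0 s) ltnS.
have gey : (s <= y)%N by have := ltn_expl s (ltnSn 1); rewrite -(strcode_nseq0 s) -/y; lia.
have apy : pow2 R (2 * a + 1 + r) <= apx s' y.
  rewrite /stage_weight -(ler_pM2r (exprn_gt0 (2 * a + 1 + r) (ltr0n R 2))) pow2V mulrAC.
  by rewrite -[leLHS](pow2V R s') [leLHS]mulrC ler_pM2r ?pow2_gt0 // -!natrX -natrM ler_nat.
have aty : at_most (nth false (row_point 0)) y.
  rewrite at_most_row_point ?row_len_gt0 // /y codevalE strval_nseq0 mul0n.
  by [].
apply: le_trans (lerD (lexx _) apy) _; rewrite /bnd /stage_mass [leRHS](big_cat_nat _ (n := s)) //=; last exact: ltnW.
apply: lerD; first by apply: ler_sum => i _; apply: stage_weight_mono => //; exact: ltnW.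
rewrite big_mkcond (bigD1_seq y) ?mem_index_iota ?iota_uniq ?gey //= aty lerDl.
by apply: sumr_ge0 => i _; case: ifP => // _; exact: stage_weight_ge0.
Qed.

(** The stages of the requests are the times of a game that cannot be played. *)
Lemma row_contradiction : False.
Proof.
have [s0 calm] := calm_eventually.
have cofinal s1 : exists2 s, (s1 <= s)%N & calm_row e sigma a s.
  by exists (maxn s0 s1); rewrite ?leq_maxr // calm // leq_maxl.
have [st [calm_st step]] := request_sequence cofinal served_eventually.
have mono i j : (i <= j)%N -> (j <= 2 ^ r)%N -> (st i <= st j)%N.
  move=> + lej; elim: j lej => [|j IH] lej; first by rewrite leqn0 => /eqP ->.
  rewrite leq_eqVlt ltnS => /orP[/eqP -> //|leij].
  by apply: leq_trans (IH (ltnW lej) leij) _; have [/ltnW] := step j lej.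
have lenE : (row_len sigma a).-1.+1 = row_len sigma a by rewrite prednK // row_len_gt0.
apply: (@game R a (row_len sigma a).-1 (fun i j => bnd (st i) j)).
- by move=> t _; apply: sumr_ge0 => y _; exact: stage_weight_ge0.
- by move=> t _; exact: mass_le1.
- move=> t j ltt ltj; apply: bnd_grow; last by rewrite -lenE ltnS.
  exact: (mono _ _ (leqnSn t) ltt).
- by move=> t ltt; have [lts sv] := step t ltt; exact: served_mass.
- move=> j ltj; have /andP[/allP fin _] := calm_st 0%N (leq0n _).
  have := fin j; rewrite mem_iota add0n /= => /(_ ltj).
  have ltj1 : (j.+1 < row_len sigma a)%N by rewrite -lenE ltnS.
  rewrite !bndE ?(ltnW ltj1) // -/r; move: (boundary _ _ _ _ j) (boundary _ _ _ _ j.+1) => X Y.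
  rewrite -(ler_nat R) natrD !natrM !natrX => h.
  have := pow2V R (st 0%N); have := pow2V R (2 * a + 1 + r).
  have ps := pow2_gt0 R (st 0%N); have pr := pow2_gt0 R (2 * a + 1 + r).
  have := ler_wpM2r (ltW (mulr_gt0 ps pr)) h.
  move: (2 ^+ st 0%N) (pow2 R (st 0%N)) (2 ^+ _) (pow2 R (2 * a + 1 + r)) => B Q A P hm PA QB.
  move: hm; have -> : (X%:R * A + B) * (Q * P) = X%:R * Q * (P * A) + P * (Q * B) by ring.
  have -> : Y%:R * A * (Q * P) = Y%:R * Q * (P * A) by ring.
  by rewrite PA QB; lra.
- rewrite lenE /row_len natrX mulrC.
  have -> : (2 * a + 1 + row_exp a = 2 * a + 1 + g + (row_exp a - g))%N.
    by have := sigma_row; rewrite /g /r; lia.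
  by rewrite pow2_mulX; apply: pow2_le; move: sigma_a; rewrite /g; lia.
move=> t j b v let_ lej /andP[leb ltb] /andP[lo hi].
have /andP[_ /allP clr] := calm_st t let_.
have ltj : (j < row_len sigma a)%N by rewrite -lenE ltnS.
have := clr j; rewrite mem_iota add0n => /(_ ltj)/allP/(_ (b - a)%N).
have ltba : (b - a < scales_nb a)%N by lia.
rewrite mem_iota add0n /= => /(_ ltba); rewrite subnKC //.
move: lo hi; rewrite bndE //; set X := boundary _ _ _ _ _.
set k := scale_exp b; set m := gap_exp b; set s := st t => lo hi.
have pk := pow2_gt0 R k; have ps := pow2_gt0 R s; have pm := pow2_gt0 R (m + 1).
have pkV := pow2V R k; have psV := pow2V R s; have pmV := pow2V R (m + 1).
have lo' : (v * 2 ^ s < X * 2 ^ k)%N.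
  rewrite -(ltr_nat R) !natrM !natrX -(ltr_pM2r (mulr_gt0 ps pk)).
  have -> : v%:R * 2 ^+ s * (pow2 R s * pow2 R k) = v%:R * pow2 R k * (pow2 R s * 2 ^+ s) by ring.
  have -> : X%:R * 2 ^+ k * (pow2 R s * pow2 R k) = X%:R * pow2 R s * (pow2 R k * 2 ^+ k) by ring.
  by rewrite pkV psV !mulr1.
have hi' : (X * 2 ^ k * 2 ^ (m + 1) <= v * 2 ^ s * 2 ^ (m + 1) + 2 ^ s)%N.
  rewrite -(ler_nat R) natrD !natrM !natrX -(ler_pM2r (mulr_gt0 (mulr_gt0 ps pk) pm)).
  rewrite -addnA pow2D in hi; move: hi pkV psV pmV.
  move: (2 ^+ k) (2 ^+ s) (2 ^+ (m + 1)) (pow2 R k) (pow2 R s) (pow2 R (m + 1)).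
  move=> A B C P Q S hi PA QB SC.
  have -> : X%:R * A * C * (Q * P * S) = X%:R * Q * (P * A) * (S * C) by ring.
  have -> : (v%:R * B * C + B) * (Q * P * S) = v%:R * P * (Q * B) * (S * C) + P * S * (Q * B) by ring.
  by rewrite PA QB SC !mulr1.
have m0 : (1 < 2 ^ (m + 1))%N by rewrite addn1 -{1}(expn0 2) ltn_exp2l.
by move=> H; have := gap_mod m0 lo' hi'; rewrite H.
Qed.

End Row.
End Cone.

(** * Branches through such cones *)

Section Nowhere.
Variable R : realType.
Variable U : pfun_str.
Hypothesis optU : optimal R U.

(** Otherwise the values that are random with constant [c] would be dense in the
    cone of [sigma], and the row over it would have to play the game. *)
Lemma cone_not_random sigma c : exists tau, prefix sigma tau /\
  forall x, tau = mkseq x (size tau) -> ~ random_with U c (Omega_fun R U x).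
Proof.
have [[[e eU] freeU] opt] := optU.
apply: contrapT => none.
have dense tau : prefix sigma tau -> exists x,
    tau = mkseq x (size tau) /\ random_with U c (Omega_fun R U x).
  move=> st; apply: contrapT => no; apply: none; exists tau; split=> // x tx rx.
  by apply: no; exists x.
have c0 := computable_nth 0.
have [||M1 pM1 M1E] := @padding_machine scale_exp gap_exp.
- by rewrite /scale_exp; computability.
- by rewrite /gap_exp; computability.
have [||M2 pM2 M2E] := @padding_machine row_exp (fun=> 0%N).
- exact: computable_row_exp.
- exact: (computable_const 0).
have [M3 pM3 M3E] := push_machine e sigma.
have [c1 H1] := optimal_bound opt pM1.
have [c2 H2] := optimal_bound opt pM2.
have [c3 H3] := optimal_bound opt pM3.
(* [a] bounds the constants of the three machines, so that a codeword of header
   [b >= a] loses at most another [b]. *)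
pose a := maxn (size sigma) (maxn c (maxn c1 (maxn c2 c3))).
apply: (@row_contradiction R U e eU freeU sigma a c) => //.
- by rewrite leq_maxl.
- move=> b w leab szw; have := H1 _ _ (M1E b w szw); rewrite size_header szw => le.
  apply: (@le_trans _ _ ((b + (scale_exp b).+1 + c1 + c.+1)%:R%:E)).
    by rewrite [(_ + c.+1)%:R]natrD EFinD leeD2r.
  by rewrite lee_fin ler_nat; move: leab; rewrite /a /gap_exp; lia.
- move=> w szw; have := H2 _ _ (M2E a w szw); rewrite cats0 size_header szw => le.
  by apply: le_trans le _; rewrite lee_fin ler_nat /a; lia.
- move=> s rs lts; have [w szw Mw] := M3E a s rs lts.
  have := H3 _ _ Mw; rewrite size_header szw => le.
  by apply: le_trans le _; rewrite lee_fin ler_nat /a; lia.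
Qed.

End Nowhere.

Section Scheme.
Variable ext : bitseq -> nat -> bitseq.
Hypothesis ext_prefix : forall s c, prefix s (ext s c).

Fixpoint node (alpha : nat -> bool) n : bitseq :=
  if n is n'.+1 then rcons (ext (node alpha n') n') (alpha n') else [::].

Definition branch alpha i := nth false (node alpha i.+1) i.

Lemma node_prefix alpha m n : (m <= n)%N -> prefix (node alpha m) (node alpha n).
Proof.
elim: n => [|n IH]; first by rewrite leqn0 => /eqP ->; exact: prefix_refl.
rewrite leq_eqVlt ltnS => /orP[/eqP -> |lemn]; first exact: prefix_refl.
apply: prefix_trans (IH lemn) _; apply: prefix_trans (ext_prefix _ n) _.
by rewrite /= prefix_rcons.
Qed.

Lemma size_node alpha n : (n <= size (node alpha n))%N.
Proof.
elim: n => // n IH; rewrite /= size_rcons ltnS (leq_trans IH) //.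
exact/size_prefix/ext_prefix.
Qed.

Lemma nth_prefix (s t : bitseq) i : prefix s t -> (i < size s)%N -> nth false s i = nth false t i.
Proof. by move=> /prefixP[u ->] lti; rewrite nth_cat lti. Qed.

Lemma node_branch alpha s n : prefix s (node alpha n) -> s = mkseq (branch alpha) (size s).
Proof.
move=> sn; apply: (@eq_from_nth _ false) => [|i lti]; first by rewrite size_mkseq.
rewrite nth_mkseq // /branch (nth_prefix sn lti).
case: (leqP n i.+1) => le.
  by rewrite (nth_prefix (node_prefix alpha le)) // (leq_trans lti) // size_prefix.
by rewrite -(nth_prefix (node_prefix alpha (ltnW le))) // size_node.
Qed.

Lemma branch_inj : injective branch.
Proof.
move=> alpha beta E; have same n : node alpha n = node beta n -> alpha n = beta n.
  move=> En; have := node_branch (prefix_refl (node alpha n.+1)).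
  rewrite E; have -> : size (node alpha n.+1) = size (node beta n.+1).
    by rewrite /= !size_rcons En.
  rewrite -(node_branch (prefix_refl (node beta n.+1))) /= En.
  by move=> /rcons_inj[].
have nodes n : node alpha n = node beta n.
  by elim: n => //= n IH; rewrite IH (same n IH).
by apply: funext => n; apply: same.
Qed.

Lemma branch_ext alpha n :
  ext (node alpha n) n = mkseq (branch alpha) (size (ext (node alpha n) n)).
Proof. by apply: (@node_branch _ _ n.+1); rewrite /= prefix_rcons. Qed.

End Scheme.

Theorem corollary5p14 (R : realType) (U : pfun_str) (hU : optimal R U) :
  ([set x : nat -> bool | ~ random_real U (Omega_fun R U x)]
    #= [set: nat -> bool])%card.
Proof.
have /boolp.choice [f fP] : forall sc : bitseq * nat, exists tau, prefix sc.1 tau /\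
    forall x, tau = mkseq x (size tau) -> ~ random_with U sc.2 (Omega_fun R U x).
  by move=> [s c]; exact: cone_not_random.
pose ext s c := f (s, c); have ext_prefix s c : prefix s (ext s c) by case: (fP (s, c)).
apply/card_eqPle; split; first exact: card_leT.
rewrite -(card_le_eql (inj_card_eq (A := [set: nat -> bool]) (f := branch ext) _)); last first.
  by move=> alpha beta _ _; exact: branch_inj.
apply: subset_card_le => _ [alpha _ <-] [z zE [c zc]].
have [_] := fP (node ext alpha c, c); apply; last by exists z; [exact: zE|exact: zc].
exact: branch_ext.
Qed.
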